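(* Assume $p=p_n\to\infty$ as $n\to\infty$. Let $$L_{n,p}=\max_{1\le i<j\le n}|X_i^TX_j|,\qquad \overline{L}_{n,p}=\max_{1\le i<j\le n}(X_i^TX_j)^2 .$$ Then, as $n\to\infty$, each of $$\frac{1}{\alpha_nt_n}\big(L_{n,p}-\sqrt{1-t_n^2}\big)+\ln\big[(p_n-1)(1-t_n^2)\big]$$ and $$\frac{p_n-1}{t_n^2}\left\{\overline{L}_{n,p}-(1-t_n^2)\right\}+\ln\big[(p_n-1)(1-t_n^2)\big]$$ converges in distribution to the Gumbel distribution with cumulative distribution function $$\Lambda_1(x)=\exp\left\{-\frac{1}{\sqrt{2\pi}}e^{-x/2}\right\},\qquad x\in\mathbb{R}.$$
   Context: For each $n\ge 2$ let $p=p_n\ge 2$ be an integer and let $X_1,\ldots,X_n$ be i.i.d. random vectors uniformly distributed on the unit sphere $\mathbb S^{p-1}=\{x\in\mathbb R^p:\|x\|=1\}$ (Euclidean norm). Set $$t_n=\exp\left\{-\frac{2\ln n}{p_n-1}\right\}\in(0,1),\qquad \alpha_n=\frac{t_n}{2(p_n-1)\sqrt{1-t_n^2}}.$$ *)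

(* Defs.v *)
From HB Require Import structures.
From mathcomp Require Import all_boot all_order all_algebra.
From mathcomp Require Import all_classical all_reals all_analysis.
Set Implicit Arguments.
Unset Strict Implicit.
Unset Printing Implicit Defensive.
Import Order.TTheory GRing.Theory Num.Theory.
Import numFieldNormedType.Exports.
Local Open Scope classical_set_scope.
Local Open Scope ring_scope.

(* Points of R^p are p.-tuple R: its measurable sets, generated by the
   coordinate projections, are the Borel sets of R^p. *)

Definition dotv (R : realType) (p : nat) (x y : p.-tuple R) : R :=
  \sum_(k < p) tnth x k * tnth y k.

Definition unit_sphere (R : realType) (p : nat) : set (p.-tuple R) :=
  [set x | Num.sqrt (dotv x x) = 1].

Definition mulmx_tuple (R : realType) (p : nat) (Q : 'M[R]_p)
    (x : p.-tuple R) : p.-tuple R :=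
  [tuple \sum_(l < p) Q k l * tnth x l | k < p].

(* The uniform distribution on the sphere, i.e. normalized surface measure, is
   the Haar probability measure of the sphere as a homogeneous space of O(p):
   the only probability measure carried by the sphere that is invariant under
   orthogonal transformations. *)
Definition uniform_on_sphere (R : realType) (p : nat)
    (mu : probability (p.-tuple R) R) : Prop :=
  mu (@unit_sphere R p) = 1%E /\
  forall Q : 'M[R]_p, Q *m Q^T = 1%:M ->
  forall A : set (p.-tuple R), measurable A ->
    mu (mulmx_tuple Q @^-1` A) = mu A.

Definition mutually_independent (R : realType) (d d' : measure_display)
    (T : measurableType d) (P : probability T R) (T' : measurableType d')
    (I : finType) (X : I -> {RV P >-> T'}) : Prop :=
  forall (J : {set I}) (A : I -> set T'), (forall i, measurable (A i)) ->
    P (\bigcap_(i in [set` J]) (X i @^-1` A i)) =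
    (\prod_(i in J) P (X i @^-1` A i))%E.

(* The variables Y n need not share a probability space. *)
Definition cvg_in_distribution (R : realType) (d : nat -> measure_display)
    (T : forall n, measurableType (d n)) (P : forall n, probability (T n) R)
    (Y : forall n, T n -> R) (F : R -> R) : Prop :=
  (forall n, measurable_fun setT (Y n)) /\
  forall x : R, {for x, continuous F} ->
    P n [set w | Y n w <= x] @[n --> \oo] --> (F x)%:E.

Definition tpar (R : realType) (n p : nat) : R :=
  expR (- (2 * ln n%:R / (p%:R - 1))).

Definition alphapar (R : realType) (n p : nat) : R :=
  tpar R n p / (2 * (p%:R - 1) * Num.sqrt (1 - tpar R n p ^+ 2)).

(* All terms are nonnegative, so for n >= 2 the default value 0 of the two
   maxima below has no effect. *)
Definition coherence (R : realType) (n p : nat) (x : 'I_n -> p.-tuple R) : R :=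
  \big[Num.max/0]_(ij : 'I_n * 'I_n | (ij.1 < ij.2)%N)
    `|dotv (x ij.1) (x ij.2)|.

Definition sq_coherence (R : realType) (n p : nat) (x : 'I_n -> p.-tuple R) : R :=
  \big[Num.max/0]_(ij : 'I_n * 'I_n | (ij.1 < ij.2)%N)
    dotv (x ij.1) (x ij.2) ^+ 2.

Definition Lambda1 (R : realType) (x : R) : R :=
  expR (- ((Num.sqrt (2 * pi))^-1 * expR (- (x / 2)))).

(* Main.v *)
Require Import Defs.
From HB Require Import structures.
From mathcomp Require Import all_boot all_order all_algebra.
From mathcomp Require Import all_classical all_reals all_analysis.
From mathcomp Require Import measurable_realfun ring lra.
Set Implicit Arguments.
Unset Strict Implicit.
Unset Printing Implicit Defensive.
Import Order.TTheory GRing.Theory Num.Theory.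
Import numFieldNormedType.Exports.
Local Open Scope classical_set_scope.
Local Open Scope ring_scope.

(** Call a pair of indices an edge when the squared inner product of its vectors
    exceeds a threshold [rho]. Given the other vectors, an edge at [X_l] has a
    probability [q] that does not depend on them, since all caps of the same size
    have the same measure. Hence the probability [a_k] of seeing no edge among the
    first [k] vectors satisfies [a_(k+1) = (1 - k q) a_k + O(k^2 q^2)], by
    Bonferroni, and [a_n = exp (- q n (n - 1) / 2) + O(n^3 q^2)].

    The cap probability [q] is computed from rotation invariance alone: a rotation
    in a coordinate plane gives a recursion for the even moments of a coordinate,
    which the moments of [sin^2] with weight [cos^(p - 2)] on [[0, pi / 2]] satisfy
    too, and moments determine the tail by approximating indicators by
    polynomials. The tail integral of [cos^(p - 2)] is then sandwiched by explicit
    antiderivatives and normalized by Wallis' product, which gives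
    [q ~ sqrt (2 / pi) (1 - rho)^((p - 1) / 2) / sqrt ((p - 1) rho)] as soon as
    [(p - 1) rho] is large. Substituting the thresholds of the two statistics
    makes [n^2 q / 2] converge to [exp (- x / 2) / sqrt (2 pi)]. *)

(** * Independence of one vector from the others *)

(** Uniformity is given only as mass one on the sphere and invariance under orthogonal maps, so no
    density of a coordinate is at hand; this is why the cap probability is reached through moments.
    Comparing two laws by polynomials costs a gap between two levels; the explicit tail bounds are
    continuous in the level and close it. The recursion works because the absence of edges among
    earlier vectors is an event of vectors other than the new one. Edges at a common vector are
    pairwise independent, which controls the second Bonferroni term, and with [q] of order [n^-2]
    the total error [n^3 q^2] is of order [1 / n]. The parameter [t] satisfies [t^(p - 1) = n^-2],
    which cancels the [n^2] in the number of pairs. What remains is governed by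
    [v = (p - 1) (1 - t^2)], which tends to infinity however [p] grows against [ln n]; the term
    [ln v] in the centring compensates the square root in the denominator of [q]. The first
    statistic reduces to the second by squaring its threshold, which perturbs [x] by a vanishing
    amount; hence the limit is proved along levels [c n] tending to [x]. *)

Section IndependenceOffOneIndex.
Context (R : realType) (d d' : measure_display) (T : measurableType d)
  (P : probability T R) (T' : measurableType d') (I : finType)
  (X : I -> {RV P >-> T'}).
Hypothesis indX : mutually_independent X.

(** A pi-system generating the sigma-algebra of all the variables except [X l]. Its members have
    exactly the product form that [mutually_independent] speaks about. *)
Definition cylinders_off (l : I) : set (set T) :=
  [set B | exists2 A : I -> set T', forall i, measurable (A i) &
     B = \bigcap_(i in [set` [set~ l]%SET]) (X i @^-1` A i)].

Lemma cylinders_off_setI l : setI_closed (cylinders_off l).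
Proof.
move=> _ _ [A mA ->] [B mB ->]; exists (fun i => A i `&` B i) => [i|].
  exact: measurableI.
apply/seteqP; split=> w /=.
  by move=> [wA wB] i il; split; [exact: wA|exact: wB].
by move=> wAB; split=> i il; have [] := wAB i il.
Qed.

Lemma measurable_RV i A : measurable A -> measurable (X i @^-1` A).
Proof. by move=> mA; rewrite -[_ @^-1` _]setTI; exact: measurable_funP. Qed.

Lemma cylinders_off_measurable l B : cylinders_off l B -> measurable B.
Proof.
move=> [A mA ->]; apply: fin_bigcap_measurable => // i _; exact: measurable_RV.
Qed.

Lemma sigma_off_measurable l B : <<s cylinders_off l >> B -> measurable B.
Proof.
apply: smallest_sub; first exact: sigma_algebra_measurable.
exact: cylinders_off_measurable.
Qed.

Lemma cylinders_off_indep l A B : measurable A -> cylinders_off l B ->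
  P (B `&` X l @^-1` A) = (P B * P (X l @^-1` A))%E.
Proof.
move=> mA [C mC ->].
(* Inserting [A] at the free index makes the intersection a cylinder over all of [I]; independence
   is then used twice, for [I] and for [I] without [l]. *)
pose D i := if i == l then A else C i.
have mD i : measurable (D i) by rewrite /D; case: ifP.
have -> : \bigcap_(i in [set` [set~ l]%SET]) (X i @^-1` C i) `&` X l @^-1` A =
    \bigcap_(i in [set` [set: I]%SET]) (X i @^-1` D i).
  apply/seteqP; split=> w /=.
    move=> [wC wA] i _; rewrite /D /=; have [->//|il] := eqVneq i l.
    by apply: wC => /=; rewrite !inE.
  move=> wD; split=> [i il|].
    have := wD i; rewrite /D /=; move: il; rewrite /= !inE => /negbTE ->; exact.
  by have := wD l; rewrite /D /= eqxx; apply; rewrite inE.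
rewrite !indX // (bigD1 l) ?inE //= muleC; congr (_ * _)%E.
  apply: eq_big => i; first by rewrite !inE.
  by rewrite /D => /andP[_ /negbTE ->].
by rewrite /D eqxx.
Qed.

(** Dynkin's theorem: the identity holds on the pi-system of cylinders, and the sets [B] satisfying
    it are closed under complements and countable disjoint unions. *)
Lemma sigma_off_indep l A B : measurable A -> <<s cylinders_off l >> B ->
  P (B `&` X l @^-1` A) = (P B * P (X l @^-1` A))%E.
Proof.
move=> mA; have mXA := measurable_RV l mA.
have fXA : P (X l @^-1` A) \is a fin_num by exact: fin_num_measure.
move: B; apply: (@dynkin_induction _ (g_sigma_algebraType (cylinders_off l))
  (cylinders_off l)) => //.
- exact: cylinders_off_setI.
- by rewrite setTI probability_setT mul1e.
- by move=> B; exact: cylinders_off_indep.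
- move=> B sB PB; have mB : d.-measurable B by exact: sigma_off_measurable sB.
  have fB : P B \is a fin_num by exact: fin_num_measure.
  rewrite setIC -setDE measureD //=; last first.
    by rewrite ltey_eq fin_num_measure.
  rewrite setIC [in LHS]PB [in RHS]probability_setC //.
  by rewrite muleBl // mul1e.
- move=> F mF tF PF.
  have mF' i : d.-measurable (F i) by exact: sigma_off_measurable (mF i).
  rewrite setI_bigcupl !measure_bigcup //=; last 2 first.
  + by move=> i _; exact: measurableI.
  + exact: trivIset_setIr.
  under eq_eseriesr do rewrite PF muleC -(fineK fXA).
  rewrite nneseriesZl.
  - by rewrite muleC fineK.
  - by move=> i _; exact: measure_ge0.
Qed.

End IndependenceOffOneIndex.

(** * Rotation invariance *)

Section UniformOnSphere.
Context (R : realType) (p : nat).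
Implicit Types (x y u : p.-tuple R).

Lemma dotvC x y : dotv x y = dotv y x.
Proof. by apply: eq_bigr => k _; rewrite mulrC. Qed.

Lemma dotv_mulmx_tuple (Q : 'M[R]_p) x y :
  dotv x (mulmx_tuple Q y) = dotv (mulmx_tuple Q^T x) y.
Proof.
rewrite /dotv; under eq_bigr do rewrite tnth_mktuple mulr_sumr.
rewrite exchange_big /=; apply: eq_bigr => l _.
rewrite tnth_mktuple mulr_suml; apply: eq_bigr => k _.
by rewrite mxE mulrCA mulrA.
Qed.

Definition unit_tuple (i : 'I_p) : p.-tuple R := [tuple (k == i)%:R | k < p].

Lemma dotv_unitl i y : dotv (unit_tuple i) y = tnth y i.
Proof.
rewrite /dotv (bigD1 i) //= tnth_mktuple eqxx mul1r big1 ?addr0 // => k ki.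
by rewrite tnth_mktuple (negbTE ki) mul0r.
Qed.

Lemma dotv_unit i : dotv (unit_tuple i) (unit_tuple i) = 1.
Proof. by rewrite dotv_unitl tnth_mktuple eqxx. Qed.

Definition householder (w : 'cV[R]_p) : 'M[R]_p :=
  1%:M - (2 / (w^T *m w) 0 0) *: (w *m w^T).

Lemma householder_tr w : (householder w)^T = householder w.
Proof. by rewrite /householder linearB linearZ /= trmx1 trmx_mul trmxK. Qed.

Lemma householder_orthogonal w : (w^T *m w) 0 0 != 0 ->
  householder w *m (householder w)^T = 1%:M.
Proof.
move=> w0; rewrite householder_tr /householder; set c := 2 / _.
have wwE : w *m w^T *m (w *m w^T) = (w^T *m w) 0 0 *: (w *m w^T).
  by rewrite mulmxA -(mulmxA w) [X in w *m X]mx11_scalar mul_mx_scalar scalemxAl.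
rewrite mulmxBl !mulmxBr !mul1mx !mulmx1 -!scalemxAl -!scalemxAr wwE !scalerA.
have -> : c * c * (w^T *m w) 0 0 = c + c by rewrite /c; field.
by rewrite scalerDl opprB addrK subrK.
Qed.

(** The reflection in the hyperplane orthogonal to [x - u] exchanges two vectors of equal norm. The
    case [x = u] is excluded because the reflection divides by the squared norm of [x - u]. *)
Lemma householder_swap x u : dotv x x = 1 -> dotv u u = 1 -> x != u ->
  exists2 Q : 'M[R]_p, Q *m Q^T = 1%:M & mulmx_tuple Q^T u = x.
Proof.
move=> xx uu xu; pose w : 'cV[R]_p := \col_i (tnth x i - tnth u i).
have W : (w^T *m w) 0 0 = 2 - 2 * dotv u x.
  rewrite mxE; under eq_bigr do rewrite !mxE mulrBl !mulrBr opprB.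
  rewrite !big_split /= !sumrN -!/(dotv _ _) xx uu (dotvC x u); ring.
have wn0 : (w^T *m w) 0 0 != 0.
  apply: contra xu => /eqP; rewrite mxE => /eqP.
  rewrite psumr_eq0; last by move=> i _; rewrite mxE -expr2 sqr_ge0.
  move=> /allP w0; apply/eqP/eq_from_tnth => i.
  have := w0 i (mem_index_enum _); rewrite !mxE -expr2 sqrf_eq0.
  by rewrite subr_eq0 => /eqP.
exists (householder w); first exact: householder_orthogonal.
rewrite householder_tr; apply: eq_from_tnth => k; rewrite tnth_mktuple.
(* As [u] is a unit vector, the product of [w] and [u] is [dotv u x - 1], which is minus half the
   squared norm of [w]. The reflection thus adds exactly [w = x - u] to [u]. *)
have -> : \sum_(l < p) householder w k l * tnth u l =
    tnth u k - 2 / (w^T *m w) 0 0 * w k 0 * (dotv u x - 1).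
  rewrite /householder.
  under eq_bigr do rewrite !mxE big_ord1 mxE mulrBl.
  rewrite sumrB; congr (_ - _).
    rewrite (bigD1 k) //= eqxx mul1r big1 ?addr0 // => i ik.
    by rewrite eq_sym (negbTE ik) mul0r.
  rewrite -uu /dotv -sumrB mulr_sumr; apply: eq_bigr => i _; rewrite !mxE; ring.
by move: wn0; rewrite W mxE => wn0; field; exact: wn0.
Qed.

Lemma measurable_dotv d (T : measurableType d) (f g : T -> p.-tuple R) :
  measurable_fun setT f -> measurable_fun setT g ->
  measurable_fun setT (fun t => dotv (f t) (g t)).
Proof.
move=> mf mg; apply: measurable_sum => k; apply: measurable_funM.
  exact: (measurableT_comp (measurable_tnth k) mf).
exact: (measurableT_comp (measurable_tnth k) mg).
Qed.

Lemma measurable_dotv_preimage x (A : set R) : measurable A ->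
  measurable [set y | A (dotv x y)].
Proof.
move=> mA; have := @measurable_dotv _ _ (cst x) id.
move=> /(_ (measurable_cst _) (@measurable_id _ _ _)) m.
by have := m measurableT _ mA; rewrite setTI.
Qed.

Lemma measurable_dotv1 : measurable [set y : p.-tuple R | dotv y y = 1].
Proof.
have := @measurable_dotv _ _ id id (@measurable_id _ _ _) (@measurable_id _ _ _).
by move=> /(_ measurableT [set 1] (measurable_set1 _)); rewrite setTI.
Qed.

(** All caps of one size have one measure: an orthogonal map carrying [u] to [x] moves across the
    inner product by transposition, and [mu] is invariant under it. *)
Lemma dotv_law_unit (mu : probability (p.-tuple R) R) (A : set R) x u :
  uniform_on_sphere mu -> measurable A -> dotv x x = 1 -> dotv u u = 1 ->
  mu [set y | A (dotv x y)] = mu [set y | A (dotv u y)].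
Proof.
move=> [_ inv] mA xx uu; have [->//|xu] := eqVneq x u.
have [Q QQ Qu] := householder_swap xx uu xu.
rewrite -[RHS](inv Q QQ); last exact: measurable_dotv_preimage.
by congr (mu _); apply/seteqP; split=> y /=; rewrite dotv_mulmx_tuple Qu.
Qed.

Lemma sphere_dotv (mu : probability (p.-tuple R) R) :
  uniform_on_sphere mu -> mu [set x | dotv x x = 1] = 1%E.
Proof.
move=> [s1 _]; rewrite -s1; congr (mu _); apply/seteqP; split=> x.
  by rewrite /= /unit_sphere /= => ->; rewrite sqrtr1.
rewrite /unit_sphere /= => s; have : 0 <= dotv x x.
  by apply: sumr_ge0 => i _; rewrite -expr2 sqr_ge0.
by move=> /sqr_sqrtr; rewrite s expr1n.
Qed.

End UniformOnSphere.

(** * Edge probabilities on events determined by the other vectors *)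

Section LawOnEvent.
Context (R : realType) (d d' : measure_display) (T : measurableType d)
  (T' : measurableType d') (P : probability T R).
Variables (B : set T) (mB : measurable B) (f : {mfun T >-> T'}).

(** The law of [f] on the event [B], kept unnormalized so that events of probability zero are
    covered. It is a finite measure, hence eligible for uniqueness of product measures. *)
Definition law_on : set T' -> \bar R := pushforward (mrestr P mB) f.

Let law_on0 : law_on set0 = 0%E. Proof. exact: measure0. Qed.

Let law_on_ge0 A : (0 <= law_on A)%E. Proof. exact: measure_ge0. Qed.

Let law_on_sigma_additive : semi_sigma_additive law_on.
Proof. exact: measure_semi_sigma_additive. Qed.

HB.instance Definition _ := isMeasure.Build _ _ _ law_on
  law_on0 law_on_ge0 law_on_sigma_additive.

Let law_on_finite : fin_num_fun law_on.
Proof.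
move=> U mU; rewrite /law_on /pushforward /mrestr.
apply: fin_num_measure; apply: measurableI => //.
by rewrite -[_ @^-1` _]setTI; exact: measurable_funP.
Qed.

HB.instance Definition _ := Measure_isFinite.Build _ _ _ law_on law_on_finite.

End LawOnEvent.

Section PairMfun.
Context (d d1 d2 : measure_display) (T : measurableType d)
  (T1 : measurableType d1) (T2 : measurableType d2)
  (f : {mfun T >-> T1}) (g : {mfun T >-> T2}).

Definition pair_mfun (w : T) : T1 * T2 := (f w, g w).

Let measurable_pair_mfun : measurable_fun setT pair_mfun.
Proof. exact: measurable_fun_pair. Qed.

HB.instance Definition _ :=
  isMeasurableFun.Build _ _ _ _ pair_mfun measurable_pair_mfun.

End PairMfun.

Section EdgeProbability.
Context (R : realType) (d : measure_display) (T : measurableType d)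
  (P : probability T R) (I : finType) (p : nat)
  (X : I -> {RV P >-> p.-tuple R}).
Hypothesis indX : mutually_independent X.
Hypothesis unifX : forall i, uniform_on_sphere (distribution P (X i)).

Definition edge (r : R) (i j : I) : set T :=
  [set w | r < dotv (X i w) (X j w) ^+ 2].

Lemma edgeC r i j : edge r i j = edge r j i.
Proof. by apply/seteqP; split=> w; rewrite /edge /= dotvC. Qed.

Lemma measurable_sqr_gt r : measurable [set x : R | r < x ^+ 2].
Proof.
have := @measurable_funX _ _ R setT id 2 (@measurable_id _ _ _).
move=> /(_ measurableT `]r, +oo[%classic (measurable_itv _)); rewrite setTI.
by congr (measurable _); apply/seteqP; split => x /=; rewrite in_itv /= andbT.
Qed.

Lemma measurable_edge r i j : measurable (edge r i j).
Proof.
have m := @measurable_dotv R p _ _ (X i) (X j)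
  (measurable_funP (X i)) (measurable_funP (X j)).
by have := m measurableT _ (measurable_sqr_gt r); rewrite setTI.
Qed.

Lemma sigma_off_RV l k A : k != l -> measurable A ->
  <<s cylinders_off X l >> (X k @^-1` A).
Proof.
move=> kl mA; apply: sub_gen_smallest.
exists (fun i => if i == k then A else setT) => [i|]; first by case: ifP.
apply/seteqP; split=> w /=; last first.
  by move=> /(_ k); rewrite /= !inE eqxx; apply.
by move=> XA i _; case: eqP => [->|].
Qed.

Lemma sigma_off_edge r l i j : i != l -> j != l ->
  <<s cylinders_off X l >> (edge r i j).
Proof.
(* On [T] equipped with the coarser sigma-algebra, [X i] and [X j] are still measurable, so
   membership of the edge follows from measurability of the inner product. *)
move=> il jl; pose TG := g_sigma_algebraType (cylinders_off X l).
have mX k : k != l -> measurable_fun (setT : set TG) (X k : TG -> p.-tuple R).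
  by move=> kl _ A mA; rewrite setTI; exact: sigma_off_RV.
have m := measurable_dotv (mX i il) (mX j jl).
by have := m measurableT _ (measurable_sqr_gt r); rewrite setTI.
Qed.

(* Given the other vectors, the cap around [X j] has a probability that does not
   depend on [X j]: independence and Fubini. *)
Lemma edge_indep (u : p.-tuple R) r j l B : dotv u u = 1 -> j != l ->
  <<s cylinders_off X l >> B ->
  P (B `&` edge r j l) =
  (P B * distribution P (X l) [set y | r < dotv u y ^+ 2]%R)%E.
Proof.
move=> uu jl sB; have mB := sigma_off_measurable sB.
pose E := [set z : p.-tuple R * p.-tuple R | r < dotv z.1 z.2 ^+ 2].
have mE : measurable E.
  have := @measurable_dotv R p _ _ fst snd (@measurable_fst _ _ _ _)
    (@measurable_snd _ _ _ _).
  by move=> /(_ measurableT _ (measurable_sqr_gt r)); rewrite setTI.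
set q := distribution P (X l) _.
(* On [B] the pair [(X j, X l)] has a product law: [B] and the event that [X j] lies in [A] both
   belong to the sigma-algebra off [l], hence so does their intersection. *)
have rect A C : measurable A -> measurable C ->
    law_on P mB (pair_mfun (X j) (X l)) (A `*` C) =
    (law_on P mB (X j) A * distribution P (X l) C)%E.
  move=> mA mC; rewrite /law_on /distribution /pushforward /mrestr /=.
  rewrite -(sigma_off_indep indX mC); last first.
    rewrite setIC; apply: (@measurableI _
      (g_sigma_algebraType (cylinders_off X l))) => //.
    exact: sigma_off_RV.
  congr (P _); apply/seteqP; split=> w /=; first by move=> [[? ?] ?].
  by move=> [[? ?] ?].
rewrite setIC -[LHS]/(law_on P mB (pair_mfun (X j) (X l)) E).
rewrite -(product_measure_unique rect mE).
rewrite /product_measure1 /=.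
transitivity (\int[law_on P mB (X j)]_x (cst q x))%E; last first.
  rewrite integral_cst //= muleC /law_on /pushforward /mrestr.
  by rewrite preimage_setT setTI.
pose S := [set x : p.-tuple R | dotv x x = 1].
have mS : measurable S by exact: measurable_dotv1.
(* The section of [E] at [x] has measure [q] when [x] is a unit vector; the other [x] form a null
   set for the law of [X j]. *)
apply: ge0_ae_eq_integral => //=.
- exact: (measurable_fun_xsection (distribution P (X l)) mE).
- by move=> x _; exact: measure_ge0.
- exists (~` S); split.
  + exact: measurableC.
  + apply/eqP; rewrite eq_le measure_ge0 andbT.
    rewrite (le_trans (y := distribution P (X j) (~` S))) //.
      apply: le_measure; rewrite ?inE //=.
      * apply: measurableI => //; exact: (measurable_RV X j (measurableC mS)).
      * exact: (measurable_RV X j (measurableC mS)).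
    by rewrite probability_setC // (sphere_dotv (unifX j)) subee.
  + move=> x /=; apply: contra_not => xx _.
    rewrite xsectionE /q.
    exact: (dotv_law_unit (unifX l) (measurable_sqr_gt r) xx uu).
Qed.

End EdgeProbability.

(** * The probability that there is no edge *)

Lemma expRN_linear_approx (R : realType) (x : R) : 0 <= x ->
  `|expR (- x) - (1 - x)| <= x ^+ 2.
Proof.
move=> x0; have lo := expR_ge1Dx (- x).
have up : expR (- x) <= 1 - x + x ^+ 2.
  rewrite expRN; have e1 := expR_ge1Dx x.
  rewrite -[leLHS]mul1r ler_pdivrMr ?expR_gt0 //.
  have y0 : 0 <= 1 - x + x ^+ 2 by nra.
  (* It suffices to replace [expR x] by [1 + x], because [(1 - x + x^2) (1 + x) = 1 + x^3 >= 1]. *)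
  have : 0 <= (1 - x + x ^+ 2) * (expR x - (1 + x)).
    by rewrite mulr_ge0 // subr_ge0.
  have : 0 <= x ^+ 3 by rewrite exprn_ge0.
  by rewrite !exprS expr0; nra.
by rewrite ler_norml; apply/andP; split; nra.
Qed.

Section NoEdge.
Context (R : realType) (d : measure_display) (T : measurableType d)
  (P : probability T R) (n p : nat) (X : 'I_n -> {RV P >-> p.-tuple R}).
Hypothesis indX : mutually_independent X.
Hypothesis unifX : forall i, uniform_on_sphere (distribution P (X i)).
Variables (r : R) (u : p.-tuple R) (q : R).
Hypothesis uu : dotv u u = 1.
Hypothesis capE :
  forall l, distribution P (X l) [set y | r < dotv u y ^+ 2] = q%:E.

Let Pr (A : set T) : R := fine (P A).

Let PrE A : measurable A -> (Pr A)%:E = P A.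
Proof. by move=> mA; rewrite fineK // fin_num_measure. Qed.

Let Pr_le A B : measurable A -> measurable B -> A `<=` B -> Pr A <= Pr B.
Proof. by move=> mA mB AB; rewrite -lee_fin !PrE // le_measure // inE. Qed.

Let Pr_setD A B : measurable A -> measurable B ->
  Pr (A `\` B) = Pr A - Pr (A `&` B).
Proof.
move=> mA mB; apply: EFin_inj; rewrite EFinB !PrE //; last 2 first.
- exact: measurableI.
- exact: measurableD.
by rewrite measureD // ltey_eq fin_num_measure.
Qed.

Let Pr_setU_le A B : measurable A -> measurable B ->
  Pr (A `|` B) <= Pr A + Pr B.
Proof.
move=> mA mB; rewrite -lee_fin EFinD !PrE //; last exact: measurableU.
exact: measureU2.
Qed.

Definition noedge (k : nat) : set T :=
  [set w | forall i j : 'I_n, (i < j)%N -> (j < k)%N -> ~ edge X r i j w].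

Lemma noedge_bigcap k : noedge k = \bigcap_(ij in
    [set` [set ij : 'I_n * 'I_n | (ij.1 < ij.2)%N && (ij.2 < k)%N]%SET])
  ~` edge X r ij.1 ij.2.
Proof.
apply/seteqP; split=> w /=.
  by move=> N [i j]; rewrite /= inE => /andP[]; exact: N.
by move=> N i j ij jk; apply: (N (i, j)); rewrite /= inE ij.
Qed.

Lemma measurable_noedge k : measurable (noedge k).
Proof.
rewrite noedge_bigcap; apply: fin_bigcap_measurable => // ij _.
apply: measurableC; exact: measurable_edge.
Qed.

(** Edges counted by [noedge l] join indices below [l], so the event is independent of [X l]; this
    is what allows adding the vectors one at a time. *)
Lemma sigma_off_noedge (l : 'I_n) : <<s cylinders_off X l >> (noedge l).
Proof.
rewrite noedge_bigcap.
apply: (@fin_bigcap_measurable _ (g_sigma_algebraType (cylinders_off X l)))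
  => //.
move=> [i j]; rewrite /= inE /= => /andP[ij jl].
apply: (@measurableC _ (g_sigma_algebraType (cylinders_off X l))).
apply: sigma_off_edge; apply/eqP => e; move: ij jl.
  by rewrite e => /ltn_trans /[apply]; rewrite ltnn.
by rewrite e ltnn.
Qed.

Let q_ge0 (l : 'I_n) : 0 <= q.
Proof. by rewrite -lee_fin -(capE l) measure_ge0. Qed.

Let Pr_edgeI (j l : 'I_n) B : j != l -> <<s cylinders_off X l >> B ->
  Pr (B `&` edge X r j l) = Pr B * q.
Proof.
move=> jl sB; apply: EFin_inj; rewrite EFinM !PrE.
- by rewrite (edge_indep indX unifX r uu jl sB) capE.
- exact: sigma_off_measurable sB.
- apply: measurableI; last exact: measurable_edge.
  exact: sigma_off_measurable sB.
Qed.

Let Pr_edge (j l : 'I_n) : j != l -> Pr (edge X r j l) = q.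
Proof.
move=> jl; rewrite -[edge X r j l]setTI Pr_edgeI //.
  by rewrite /Pr probability_setT mul1r.
exact: (@measurableT _ (g_sigma_algebraType (cylinders_off X l))).
Qed.

(** Two edges sharing [l] are independent: turn the second one around so that [X j] is its new
    vector, which the edge from [i] to [l] does not involve. *)
Let Pr_edge2 (i j l : 'I_n) : i != l -> j != l -> i != j ->
  Pr (edge X r i l `&` edge X r j l) = q ^+ 2.
Proof.
move=> il jl ij; have lj : l != j by rewrite eq_sym.
rewrite (edgeC X r j l) (Pr_edgeI lj) ?(Pr_edge il) ?expr2 //.
exact: sigma_off_edge.
Qed.

(* The Bonferroni inequalities for the edges joining [l] to the first [m]
   vectors. *)
Lemma Pr_noedge_star (l : 'I_n) m : (m <= l)%N ->
  let D := noedge l `\` [set w | exists2 j : 'I_n, (j < m)%N & edge X r j l w] in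
  measurable D /\
  Pr (noedge l) * (1 - m%:R * q) <= Pr D
    <= Pr (noedge l) * (1 - m%:R * q) + m%:R ^+ 2 * q ^+ 2.
Proof.
have q0 := q_ge0 l; have mN := measurable_noedge l.
elim: m => [_|m IH ml] /=.
  rewrite (_ : [set w | _] = set0); last by apply/seteqP; split=> w //= -[].
  by rewrite setD0 mul0r subr0 mulr1 expr0n mul0r addr0 lexx.
set D' := _ `\` _; pose D := noedge l `\`
  [set w | exists2 j : 'I_n, (j < m)%N & edge X r j l w].
have [mD /andP[lo up]] := IH (ltnW ml); rewrite -/D in mD lo up.
pose jm : 'I_n := Ordinal (ltn_trans ml (ltn_ord l)).
have jl : jm != l by rewrite -val_eqE /= ltn_eqF.
have mE := measurable_edge X r jm l.
have D'E : D' = D `\` edge X r jm l.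
  apply/seteqP; split=> w /=.
    move=> [Nw nE]; split.
      split=> // -[j jm' Ej]; apply: nE; exists j => //.
      exact: ltn_trans jm' _.
    by move=> E; apply: nE; exists jm => /=.
  move=> [[Nw nE] nE']; split=> // -[j]; rewrite ltnS leq_eqVlt => /orP[|].
    move=> /eqP e; rewrite (_ : j = jm) //; exact: val_inj.
  by move=> jm' E; apply: nE; exists j.
split; first by rewrite D'E; exact: measurableD.
(* First Bonferroni inequality: the edges already excluded in [D] are ignored. *)
have up1 : Pr (D `&` edge X r jm l) <= Pr (noedge l) * q.
  rewrite -(Pr_edgeI jl (@sigma_off_noedge l)).
  by apply: Pr_le; [exact: measurableI|exact: measurableI|move=> w [[]]].
have lo1 : Pr (noedge l) * q <= Pr (D `&` edge X r jm l) + m%:R * q ^+ 2.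
  rewrite -(Pr_edgeI jl (@sigma_off_noedge l)).
  (* Second Bonferroni inequality: what [D] loses of the new edge is covered by at most [m] pairs of
     edges at [l], each of probability [q^2]. Summed over the steps, these losses stay below
     [m^2 q^2]. *)
  have : forall m', (m' <= m)%N ->
    let U := [set w | exists2 j : 'I_n, (j < m')%N & edge X r j l w] `&`
      edge X r jm l in measurable U /\ Pr U <= m'%:R * q ^+ 2.
    elim=> [_|m' IH' m'm] /=.
      rewrite (_ : _ `&` _ = set0); last by apply/seteqP; split=> w //= -[[]].
      by rewrite /Pr measure0 mul0r.
    have [mU PU] := IH' (ltnW m'm); set U := _ `&` _ in mU PU.
    pose j' : 'I_n := Ordinal (ltn_trans m'm (ltn_trans ml (ltn_ord l))).
    set U' := _ `&` _.
    have U'E : U' = U `|` (edge X r j' l `&` edge X r jm l).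
      apply/seteqP; split=> w /=.
        move=> [[j]]; rewrite ltnS leq_eqVlt => /orP[/eqP e|jm'] Ej Em.
          by right; split=> //; rewrite (_ : j' = j) //; apply: val_inj.
        by left; split=> //; exists j.
      move=> [[[j jm' Ej] Em]|[Ej Em]]; split=> //.
        by exists j => //; exact: ltn_trans jm' _.
      by exists j' => /=.
    have mE2 : measurable (edge X r j' l `&` edge X r jm l).
      by apply: measurableI => //; exact: measurable_edge.
    split; first by rewrite U'E; exact: measurableU.
    rewrite U'E (le_trans (Pr_setU_le mU mE2)) // Pr_edge2 //.
    - by rewrite -natr1 mulrDl mul1r lerD2r.
    - by rewrite -val_eqE /= ltn_eqF // (ltn_trans m'm).
    - by rewrite -val_eqE /= ltn_eqF.
  move=> /(_ m (leqnn m)) [mU PU].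
  apply: (le_trans _ (lerD (lexx _) PU)).
  apply: (le_trans _ (Pr_setU_le _ mU)); last exact: measurableI.
  apply: Pr_le.
  - exact: measurableI.
  - by apply: measurableU => //; exact: measurableI.
  - move=> w [Nw Ew]; have [U|nU] :=
      pselect (exists2 j : 'I_n, (j < m)%N & edge X r j l w); first by right.
    by left.
rewrite D'E Pr_setD //.
have m0 : 0 <= m%:R :> R by exact: ler0n.
have qq : 0 <= q ^+ 2 by exact: sqr_ge0.
by rewrite -natr1; apply/andP; split; nra.
Qed.

(** The case [m = l] of the star estimate: passing from [l] to [l + 1] vectors creates only the [l]
    edges that end at [X l]. *)
Lemma noedge_step (l : 'I_n) :
  `|Pr (noedge l.+1) - (1 - l%:R * q) * Pr (noedge l)| <= (l%:R * q) ^+ 2.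
Proof.
have [_ /andP[lo up]] := Pr_noedge_star (leqnn l).
rewrite (_ : noedge l.+1 = noedge l `\`
    [set w | exists2 j : 'I_n, (j < l)%N & edge X r j l w]).
  by rewrite mulrC exprMn ler_norml; apply/andP; split; nra.
apply/seteqP; split=> w /=.
  move=> N; split=> [i j ij jl|[j jl]].
    by apply: N => //; exact: ltn_trans jl _.
  exact: N.
move=> [N nE] i j ij; rewrite ltnS leq_eqVlt => /orP[/eqP jl E|]; last exact: N.
by apply: nE; exists i; rewrite -?(val_inj jl) // -jl.
Qed.

(* By [noedge_step] the probabilities satisfy [a_(k+1) = (1 - k q) a_k] up to
   [(k q)^2], so [a_n] is close to the product of the [exp (- k q)]. *)
Lemma noedge_approx k : (k <= n)%N ->
  `|fine (P (noedge k)) - expR (- (q * 'C(k, 2)%:R))| <= 2 * k%:R ^+ 3 * q ^+ 2.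
Proof.
elim: k => [_|k IH kn].
  rewrite (_ : noedge 0 = setT); last by apply/seteqP; split.
  by rewrite probability_setT /= mulr0 oppr0 expR0 subrr normr0 expr0n mulr0 mul0r.
pose l := Ordinal kn; have q0 := q_ge0 l.
have := noedge_step l; rewrite -[nat_of_ord l]/k /Pr => step.
have := IH (ltnW kn) => {}IH.
set a := fine _ in step *; set b := fine _ in step IH.
have kq0 : 0 <= k%:R * q by rewrite mulr_ge0.
have := expRN_linear_approx kq0; set e := expR (- (k%:R * q)) => ekq.
have e01 : 0 <= e <= 1.
  by rewrite expR_ge0 /= -[leRHS]expR0 ler_expR oppr_le0.
have b01 : 0 <= b <= 1.
  rewrite fine_ge0 //= -lee_fin fineK ?probability_le1 //.
  - exact: measurable_noedge.
  - by apply: fin_num_measure; exact: measurable_noedge.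
rewrite binS bin1 natrD mulrDr opprD expRD (mulrC q k%:R) -/e.
set E := expR _ in IH *.
(* The three terms are the error of this step, the linearization of the exponential and the
   inherited error; [b] and [e] lie in [[0, 1]]. The constant closes because
   [2 k^2 + 2 k^3 <= 2 (k + 1)^3]. *)
have -> : a - E * e = (a - (1 - k%:R * q) * b) + (b * ((1 - k%:R * q) - e)) +
  (b - E) * e by ring.
have t1 : `|b * ((1 - k%:R * q) - e)| <= (k%:R * q) ^+ 2.
  rewrite normrM (le_trans (ler_piMl _ _)) //.
    by case/andP: b01 => b0 b1; rewrite ger0_norm.
  by rewrite distrC.
have t2 : `|(b - E) * e| <= 2 * k%:R ^+ 3 * q ^+ 2.
  rewrite normrM (le_trans (ler_piMr _ _)) //.
  by case/andP: e01 => e0 e1; rewrite ger0_norm.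
apply: (le_trans (ler_normD _ _)).
apply: (le_trans (lerD (ler_normD _ _) t2)).
apply: (le_trans (lerD (lerD step t1) (lexx _))).
have k0 : 0 <= k%:R :> R by exact: ler0n.
have -> : (k%:R * q) ^+ 2 + (k%:R * q) ^+ 2 + 2 * k%:R ^+ 3 * q ^+ 2 =
  2 * (k%:R ^+ 2 + k%:R ^+ 3) * q ^+ 2 by ring.
rewrite ler_wpM2r ?sqr_ge0 // ler_pM2l // -natr1.
by rewrite !exprS !expr0; nra.
Qed.

End NoEdge.

(** * Moments of a coordinate *)

Lemma poly_ext (R : numDomainType) (f g : {poly R}) :
  (forall x, f.[x] = g.[x]) -> f = g.
Proof.
move=> fg; apply/eqP; rewrite -subr_eq0; apply/eqP.
apply: (@roots_geq_poly_eq0 _ _ [seq i%:R | i <- iota 0 (size (f - g)).+1]).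
- by apply/allP => x _; rewrite /root hornerD hornerN fg subrr.
- by rewrite map_inj_uniq ?iota_uniq //; exact: mulrIn (oner_neq0 _).
- by rewrite size_map size_iota.
Qed.

Section DotvFun.
Context (R : realType) (p : nat) (x : p.-tuple R).

Definition dotv_fun (y : p.-tuple R) : R := dotv x y.

Let measurable_dotv_fun : measurable_fun setT dotv_fun.
Proof.
by apply: measurable_dotv; [exact: measurable_cst|exact: measurable_id].
Qed.

HB.instance Definition _ :=
  isMeasurableFun.Build _ _ _ _ dotv_fun measurable_dotv_fun.

End DotvFun.

Section UniformMoments.
Context (R : realType) (p : nat) (mu : probability (p.-tuple R) R).
Hypothesis unif : uniform_on_sphere mu.

Let S := [set y : p.-tuple R | dotv y y = 1].

Let mS : measurable S. Proof. exact: measurable_dotv1. Qed.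

Let muSC : mu (~` S) = 0%E.
Proof. by rewrite probability_setC // (sphere_dotv unif) subee. Qed.

Lemma sphere_tnth_le1 (y : p.-tuple R) j : S y -> `|tnth y j| <= 1.
Proof.
move=> yy; rewrite -(@ler_pXn2r _ 2) ?nnegrE // expr1n -normrX.
rewrite ger0_norm ?sqr_ge0 // -yy /dotv (bigD1 j) //= -expr2 lerDl.
by apply: sumr_ge0 => i _; rewrite -expr2 sqr_ge0.
Qed.

(** A class containing the coordinates, closed under polynomial operations, and integrable on the
    sphere. *)
Let good (f : p.-tuple R -> R) :=
  measurable_fun setT f /\ exists c, forall y, S y -> `|f y| <= c.

Let good_integrable f : good f -> mu.-integrable S (EFin \o f).
Proof.
move=> [mf [c fc]]; apply: measurable_bounded_integrable => //.
- by rewrite ltey_eq fin_num_measure.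
- exact: measurable_funTS.
- exists c; split; first exact: num_real.
  by move=> x cx y Sy; apply: (le_trans (fc y Sy)); exact: ltW.
Qed.

Let good_tnth j : good (fun y => tnth y j).
Proof.
by split; [exact: measurable_tnth|exists 1 => y; exact: sphere_tnth_le1].
Qed.

Let goodM f g : good f -> good g -> good (fun y => f y * g y).
Proof.
move=> [mf [a fa]] [mg [b gb]]; split.
  exact: measurable_funM.
by exists (a * b) => y Sy; rewrite normrM ler_pM // ?fa ?gb.
Qed.

Let goodX f k : good f -> good (fun y => f y ^+ k).
Proof.
move=> gf; elim: k => [|k IH].
  by split; [exact: measurable_cst|exists 1 => y _; rewrite expr0 normr1].
by under eq_fun do rewrite exprS; exact: goodM.
Qed.

Let goodZ a f : good f -> good (fun y => a * f y).
Proof.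
move=> gf; apply: (goodM (f := fun=> a)) => //.
by split; [exact: measurable_cst|exists `|a|].
Qed.

Let goodD f g : good f -> good g -> good (fun y => f y + g y).
Proof.
move=> [mf [a fa]] [mg [b gb]]; split.
  exact: measurable_funD.
exists (a + b) => y Sy; rewrite (le_trans (ler_normD _ _)) //.
by rewrite lerD ?fa ?gb.
Qed.

Let good_sum (I : Type) (s : seq I) (F : I -> p.-tuple R -> R) :
  (forall i, good (F i)) -> good (fun y => \sum_(i <- s) F i y).
Proof.
move=> gF; elim: s => [|i s IH].
  under eq_fun do rewrite big_nil.
  by split; [exact: measurable_cst|exists 0 => y _; rewrite normr0].
by under eq_fun do rewrite big_cons; exact: goodD.
Qed.

Let int (f : p.-tuple R -> R) : R := \int[mu]_(y in S) f y.

Let intZ a f : good f -> int (fun y => a * f y) = a * int f.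
Proof. by move=> gf; rewrite /int RintegralZl //; exact: good_integrable. Qed.

Let int_sum (I : Type) (s : seq I) (F : I -> p.-tuple R -> R) :
  (forall i, good (F i)) ->
  int (fun y => \sum_(i <- s) F i y) = \sum_(i <- s) int (F i).
Proof.
move=> gF; elim: s => [|i s IH].
  rewrite big_nil /int; under eq_Rintegral do rewrite big_nil.
  by rewrite /Rintegral integral0.
rewrite big_cons -IH /int; under eq_Rintegral do rewrite big_cons.
by rewrite RintegralD //; apply: good_integrable => //; exact: good_sum.
Qed.

(** The integral depends only on the law of [dotv x y]. Even powers are nonnegative, so it can be
    transported to that law as a nonnegative integral. *)
Let int_law x u k : dotv x x = 1 -> dotv u u = 1 ->
  int (fun y => dotv x y ^+ (2 * k)) = int (fun y => dotv u y ^+ (2 * k)).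
Proof.
move=> xx uu.
have mpow : measurable_fun setT (fun t : R => t ^+ (2 * k)).
  apply: measurable_funX.
  exact: measurable_id.
have pow_ge0 (t : R) : (0 <= (t ^+ (2 * k))%:E)%E.
  by rewrite lee_fin exprM exprn_ge0 // sqr_ge0.
have E z : int (fun y => dotv z y ^+ (2 * k)) =
    fine (\int[distribution mu (dotv_fun z)]_t (t ^+ (2 * k))%:E)%E.
  rewrite ge0_integral_distribution //; last exact/measurable_EFinP.
  rewrite (ge0_negligible_integral _ _ _ _ muSC) //.
  - by rewrite setTD setCK.
  - exact: measurableC.
  - apply/measurable_EFinP; exact: measurableT_comp mpow _.
  - by move=> t _; exact: pow_ge0.
rewrite !E; congr fine; apply: eq_measure_integral => A mA _.
exact: (dotv_law_unit unif mA xx uu).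
Qed.

Variable i0 : 'I_p.

Definition sphere_moment k : R := \int[mu]_(y in S) (tnth y i0 ^+ (2 * k)).

(** Up to the factor [c] with [c^2 = 1 + s^2], the linear form is the coordinate of [y] along a unit
    vector of the plane of [i0] and [j]. Invariance gives the identity for every [s], hence an
    identity of polynomials in [s]. *)
Let rotation j k s : j != i0 ->
  int (fun y => (tnth y i0 + s * tnth y j) ^+ (2 * k)) =
  (1 + s ^+ 2) ^+ k * sphere_moment k.
Proof.
move=> ji; pose c := Num.sqrt (1 + s ^+ 2).
have c2 : c ^+ 2 = 1 + s ^+ 2 by rewrite sqr_sqrtr // addr_ge0 ?sqr_ge0.
have c0 : c != 0.
  by rewrite sqrtr_eq0 -ltNge (lt_le_trans ltr01) // lerDl sqr_ge0.
pose x : p.-tuple R :=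
  [tuple c^-1 * ((k == i0)%:R + s * (k == j)%:R) | k < p].
have xE y : dotv x y = c^-1 * (tnth y i0 + s * tnth y j).
  rewrite -(dotv_unitl i0) -(dotv_unitl j) /dotv !mulr_sumr -big_split /=.
  by rewrite mulr_sumr; apply: eq_bigr => l _; rewrite !tnth_mktuple; ring.
have xx : dotv x x = 1.
  rewrite xE !tnth_mktuple !eqxx (negbTE ji) eq_sym (negbTE ji) /=.
  transitivity (c^-1 ^+ 2 * (1 + s ^+ 2)); first by ring.
  by rewrite -c2 -exprMn mulVf // expr1n.
have -> : sphere_moment k = int (fun y => dotv x y ^+ (2 * k)).
  rewrite (int_law k xx (dotv_unit R i0)) /sphere_moment /int.
  by apply: eq_Rintegral => y _; rewrite dotv_unitl.
rewrite -c2 -exprM -intZ; last first.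
  have -> : (fun y => dotv x y ^+ (2 * k)) =
      (fun y => (c^-1 * (tnth y i0 + s * tnth y j)) ^+ (2 * k)).
    by apply/funext => y; rewrite xE.
  apply: goodX.
  by apply: goodZ; apply: goodD => //; exact: goodZ.
by apply: eq_Rintegral => y _; rewrite -exprMn xE mulrA mulfV // mul1r.
Qed.

(* Comparison of the coefficients of [s^2] in [rotation]. *)
Let mixed_moment j k : j != i0 ->
  (2 * k.+1 - 1)%:R * int (fun y => tnth y i0 ^+ (2 * k) * tnth y j ^+ 2) =
  sphere_moment k.+1.
Proof.
move=> ji.
pose G (l : nat) y : R := tnth y i0 ^+ (2 * k.+1 - l) * tnth y j ^+ l.
have gG l : good (G l) by apply: goodM; apply: goodX.
pose f : {poly R} :=
  \sum_(l < (2 * k.+1).+1) ('C(2 * k.+1, l)%:R * int (G l)) *: 'X^l.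
pose g : {poly R} := \sum_(l < k.+2) ('C(k.+1, l)%:R * sphere_moment k.+1) *:
  'X^(2 * l).
have fg : f = g.
  apply: poly_ext => s; rewrite !horner_sum.
  under eq_bigr do rewrite hornerZ hornerXn.
  under [RHS]eq_bigr do rewrite hornerZ hornerXn.
  transitivity (int (fun y => (tnth y i0 + s * tnth y j) ^+ (2 * k.+1))).
    under [in RHS]eq_fun do rewrite exprDn.
    rewrite int_sum; last first.
      move=> l; under eq_fun do rewrite -mulr_natl.
      by apply: goodZ; apply: goodM; apply: goodX => //; apply: goodZ.
    apply: eq_bigr => l _; rewrite mulrC mulrA -intZ //.
    apply: eq_Rintegral => y _; rewrite /G -mulr_natl exprMn; ring.
  rewrite rotation // exprDn mulr_suml; apply: eq_bigr => l _.
  rewrite expr1n mul1r -mulr_natl exprM; ring.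
have h2 : (2 < (2 * k.+1).+1)%N by rewrite ltnS mulnS leq_addr.
have := congr1 (fun h : {poly R} => h`_2) fg; rewrite !coef_sum.
rewrite (bigD1 (inord 2)) //= big1 ?addr0; last first.
  move=> l; rewrite -val_eqE /= inordK // => l2.
  by rewrite coefZ coefXn eq_sym (negbTE l2) mulr0.
rewrite (bigD1 (inord 1)) //= big1 ?addr0; last first.
  move=> l; rewrite -val_eqE /= inordK // => l1.
  rewrite coefZ coefXn -[2%N]muln1 eqn_pmul2l //.
  by rewrite eq_sym (negbTE l1) mulr0.
rewrite !inordK // !coefZ !coefXn /= !mulr1 bin1.
(* The coefficients of [s^2] are ['C(2 * k.+1, 2)] times the mixed moment and [k.+1] times the pure
   one; the common factor [k.+1] cancels. *)
have -> : 'C(2 * k.+1, 2) = (k.+1 * (2 * k.+1 - 1))%N.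
  by rewrite bin2 mulnAC -[(2 * _ * _)%N]mulnA mul2n doubleK mulnC subn1.
rewrite natrM -mulrA => /(mulfI _) <-; last by rewrite pnatr_eq0.
congr (_ * _); apply: eq_Rintegral => y _; rewrite /G.
by rewrite mulnS addKn.
Qed.

Lemma sphere_moment0 : sphere_moment 0 = 1.
Proof.
rewrite /sphere_moment; under eq_Rintegral do rewrite muln0 expr0.
rewrite Rintegral_cst // mul1r.
exact: (congr1 fine (sphere_dotv unif)).
Qed.

(** Multiply [y_i0^(2 k)] by the sum of all [y_j^2], which is 1 on the sphere, and integrate. The
    term of [i0] is the next moment; the other [p - 1] terms are equal by [mixed_moment]. *)
Lemma sphere_moment_rec k :
  (2 * k.+1 - 1)%:R * (sphere_moment k - sphere_moment k.+1) =
  p.-1%:R * sphere_moment k.+1.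
Proof.
have -> : sphere_moment k - sphere_moment k.+1 =
    \sum_(j < p | j != i0) int (fun y => tnth y i0 ^+ (2 * k) * tnth y j ^+ 2).
  apply/eqP; rewrite subr_eq; apply/eqP.
  pose F j := int (fun y => tnth y i0 ^+ (2 * k) * tnth y j ^+ 2).
  have -> : sphere_moment k.+1 = F i0.
    by apply: eq_Rintegral => y _; rewrite -exprD mulnS addnC.
  transitivity (\sum_(j < p) F j); last by rewrite (bigD1 i0) //= addrC.
  rewrite -int_sum; last by move=> j; apply: goodM; apply: goodX.
  apply: eq_Rintegral => y; rewrite inE => Sy; rewrite -mulr_sumr.
  rewrite -[LHS]mulr1 -[X in _ * X]Sy; congr (_ * _).
rewrite mulr_sumr (eq_bigr (fun=> sphere_moment k.+1)); last first.
  by move=> j; exact: mixed_moment.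
rewrite sumr_const mulr_natl; congr (_ *+ _).
by rewrite (eq_card (B := [set~ i0]%SET)) ?cardsC1 ?card_ord // => j; rewrite !inE.
Qed.

End UniformMoments.

(** * Moments determine tails *)

Lemma bernoulli_ge (R : realDomainType) (x : R) n : -1 <= x ->
  1 + n%:R * x <= (1 + x) ^+ n.
Proof.
move=> x1; elim: n => [|n IH]; first by rewrite mul0r addr0 expr0.
have n0 : 0 <= n%:R :> R by exact: ler0n.
rewrite exprSr; apply: (le_trans _ (ler_wpM2r _ IH)).
  by rewrite -natr1; nra.
by rewrite -lerBlDl sub0r.
Qed.

(* With [w = (1 + (v - s) / 2) / 2], the polynomials [(1 - w^N)^(2^N)] tend to
   the indicator of [v < s], because [2^N w^N] tends to 0 or to infinity. *)
Lemma poly_separation (R : realType) (a b e : R) : 0 <= a -> a < b -> b <= 1 ->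
  0 < e -> exists f : {poly R}, forall v, 0 <= v <= 1 ->
  [/\ 0 <= f.[v] <= 1, v <= a -> 1 - e <= f.[v] & b <= v -> f.[v] <= e].
Proof.
move=> a0 ab b1 e0; pose s := (a + b) / 2; pose dl := (b - a) / 4.
have dl0 : 0 < dl by rewrite divr_gt0 // subr_gt0.
(* [N] is taken large enough for [(1 + dl)^N >= 1 / e]. Beyond [a] and [b], the doubled base [w2] is
   at distance at least [dl] from 1, since [s] is their midpoint. *)
pose N := Num.bound (e^-1 / dl).
have growth : e^-1 <= (1 + dl) ^+ N.
  apply: (le_trans _ (bernoulli_ge N _)); last by lra.
  rewrite -lerBlDl -ler_pdivrMr //.
  apply: (@le_trans _ _ (e^-1 / dl)); first by rewrite ler_pM2r ?invr_gt0 //; lra.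
  apply: ltW; apply: archi_boundP.
  by rewrite divr_ge0 // ?invr_ge0 ltW.
exists ((1 - ((2^-1 - s / 4)%:P + 4^-1 *: 'X) ^+ N) ^+ (2 ^ N)) => v /andP[v0 v1].
have -> : ((1 - ((2^-1 - s / 4)%:P + 4^-1 *: 'X) ^+ N) ^+ (2 ^ N)).[v] =
    (1 - ((1 + (v - s) / 2) / 2) ^+ N) ^+ (2 ^ N).
  rewrite horner_exp hornerD hornerN horner_exp hornerD hornerZ hornerX !hornerC.
  by congr ((1 - _ ^+ N) ^+ _); field.
set w2 := 1 + (v - s) / 2; set w := w2 / 2.
have s01 : 0 <= s <= 1 by rewrite /s; apply/andP; split; lra.
have w01 : 0 <= w <= 1 by rewrite /w /w2; case/andP: s01 => *; apply/andP; split; lra.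
have [w0 w1] := andP w01.
have wN0 : 0 <= w ^+ N by exact: exprn_ge0.
have wN1 : w ^+ N <= 1 by exact: exprn_ile1.
have f01 : 0 <= 1 - w ^+ N <= 1 by apply/andP; split; lra.
have [f0 f1] := andP f01.
have w2N : (2 ^ N)%:R * w ^+ N = w2 ^+ N.
  by rewrite natrX -exprMn /w mulrC mulfVK.
split; first by rewrite exprn_ge0 //= exprn_ile1.
(* Bernoulli bounds the defect by [w2^N <= (1 - dl)^N], which is at most [e] because
   [(1 - dl) (1 + dl) <= 1]. *)
- move=> va; have : 1 + (2 ^ N)%:R * (- w ^+ N) <= (1 - w ^+ N) ^+ (2 ^ N).
    by apply: bernoulli_ge; lra.
  rewrite mulrN w2N; apply: le_trans; rewrite lerD2l lerN2.
  have w2d : w2 <= 1 - dl by rewrite /w2 /dl /s; lra.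
  have w20 : 0 <= w2 by move: w0; rewrite /w; lra.
  apply: (@le_trans _ _ ((1 - dl) ^+ N)).
    by apply: lerXn2r => //; rewrite nnegrE; lra.
  rewrite -[leLHS]mulr1 -[leRHS]mulr1.
  have dd : (1 - dl) ^+ N * (1 + dl) ^+ N <= 1.
    rewrite -exprMn; apply: exprn_ile1; last by nra.
    by rewrite mulr_ge0 //; lra.
  have : e * e^-1 <= e * (1 + dl) ^+ N by rewrite ler_pM2l.
  rewrite mulfV ?gt_eqF // => ee.
  rewrite !mulr1 -(@ler_pM2r _ ((1 + dl) ^+ N)) ?exprn_gt0 //; first by lra.
  by rewrite addr_gt0.
- move=> bv; have w2d : 1 + dl <= w2 by rewrite /w2 /dl /s; lra.
  have w2N' : e^-1 <= w2 ^+ N.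
    by apply: (le_trans growth); apply: lerXn2r; rewrite ?nnegrE //; lra.
  (* Bernoulli gives [w2^N <= (1 + w^N)^(2^N)], and [(1 - w^N) (1 + w^N) <= 1]. *)
  have : (1 - w ^+ N) ^+ (2 ^ N) * w2 ^+ N <= 1.
    apply: (@le_trans _ _ ((1 - w ^+ N) ^+ (2 ^ N) * (1 + w ^+ N) ^+ (2 ^ N))).
      rewrite ler_wpM2l ?exprn_ge0 //.
      have : 1 + (2 ^ N)%:R * w ^+ N <= (1 + w ^+ N) ^+ (2 ^ N).
        by apply: bernoulli_ge; lra.
      by rewrite w2N; apply: le_trans; lra.
    rewrite -exprMn; apply: exprn_ile1; first by rewrite mulr_ge0 //; lra.
    by nra.
  move=> fw; rewrite -[leRHS]mul1r -ler_pdivrMr //; apply: le_trans fw.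
  by rewrite ler_wpM2l // exprn_ge0.
Qed.

Section WeightedMoments.
Context (R : realType) (d : measure_display) (T : measurableType d)
  (mu : {measure set T -> \bar R}) (D : set T) (v g : T -> R).

(** The setting for comparing laws on [[0, 1]]: [v] is observed under the finite measure of density
    [g] with respect to [mu] on [D]. *)
Definition weighted : Prop := [/\ measurable D, measurable_fun D v,
  forall x, D x -> 0 <= v x <= 1, mu.-integrable D (EFin \o g) &
  forall x, D x -> 0 <= g x].

Hypothesis wD : weighted.

Lemma measurable_horner (f : {poly R}) : measurable_fun D (fun x => f.[v x]).
Proof.
have [_ mv _ _ _] := wD.
under eq_fun do rewrite horner_coef; apply: measurable_sum => i.
apply: measurable_funM; first exact: measurable_cst.
exact: measurable_funX.
Qed.

Lemma integrable_weighted (h : T -> R) c : measurable_fun D h ->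
  (forall x, D x -> `|h x| <= c) ->
  mu.-integrable D (EFin \o (fun x => h x * g x)).
Proof.
have [mD mv v01 ig g0] := wD => mh hc.
apply: (@le_integrable _ _ _ mu D mD _ (EFin \o (fun x => c * g x))).
- apply/measurable_EFinP; apply: measurable_funM => //.
  by apply/measurable_EFinP; exact: measurable_int ig.
- move=> x Dx /=; rewrite lee_fin !normrM ler_wpM2r //.
  exact: le_trans (hc x Dx) (ler_norm _).
- rewrite (_ : EFin \o _ = fun x : T => (c%:E * (g x)%:E)%E) //.
  exact: (integrableZl mD _ ig).
Qed.

Lemma integrable_horner (f : {poly R}) :
  mu.-integrable D (EFin \o (fun x => f.[v x] * g x)).
Proof.
have [mD mv v01 ig g0] := wD.
apply: (integrable_weighted (c := \sum_(i < size f) `|f`_i|)).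
  exact: measurable_horner.
move=> x Dx; rewrite horner_coef (le_trans (ler_norm_sum _ _ _)) //.
apply: ler_sum => i _; rewrite normrM ler_piMr // normrX exprn_ile1 //.
by have /andP[v0 v1] := v01 x Dx; rewrite ger0_norm.
Qed.

Lemma integral_horner (f : {poly R}) : \int[mu]_(x in D) (f.[v x] * g x) =
  \sum_(i < size f) f`_i * \int[mu]_(x in D) (v x ^+ i * g x).
Proof.
have [mD _ _ _ _] := wD.
have iX i : mu.-integrable D (EFin \o (fun x => v x ^+ i * g x)).
  have -> : (fun x => v x ^+ i * g x) = (fun x => ('X^i).[v x] * g x).
    by apply/funext => x; rewrite hornerXn.
  exact: integrable_horner.
have is_ (s : seq nat) :
    mu.-integrable D (EFin \o (fun x => \sum_(i <- s) f`_i * (v x ^+ i * g x))) /\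
    \int[mu]_(x in D) (\sum_(i <- s) f`_i * (v x ^+ i * g x)) =
    \sum_(i <- s) f`_i * \int[mu]_(x in D) (v x ^+ i * g x).
  elim: s => [|i s [IHi IH]].
    rewrite big_nil; split.
      rewrite (_ : EFin \o _ = cst 0%E); first exact: integrable0.
      by apply/funext => x /=; rewrite big_nil.
    under eq_Rintegral do rewrite big_nil.
    by rewrite /Rintegral integral0.
  have iZ : mu.-integrable D (EFin \o (fun x => f`_i * (v x ^+ i * g x))).
    rewrite (_ : EFin \o _ = fun x : T => ((f`_i)%:E * (v x ^+ i * g x)%:E)%E) //.
    exact: (integrableZl mD _ (iX i)).
  split.
    rewrite (_ : EFin \o _ = fun x : T => ((f`_i * (v x ^+ i * g x))%:E +
      (\sum_(i <- s) f`_i * (v x ^+ i * g x))%:E)%E).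
      exact: (integrableD mD iZ IHi).
    by apply/funext => x /=; rewrite big_cons EFinD.
  rewrite big_cons -IH -RintegralZl // -RintegralD //.
  by apply: eq_Rintegral => x _; rewrite big_cons.
have [_] := is_ (index_iota 0 (size f)); rewrite big_mkord => <-.
apply: eq_Rintegral => x _; rewrite horner_coef big_mkord mulr_suml.
by apply: eq_bigr => i _; rewrite mulrA.
Qed.

End WeightedMoments.

(** A polynomial that is nearly 1 below [a] and nearly 0 above [b] has the same integral on both
    sides. The room between [a] and [b] is what such a polynomial requires. *)
Lemma moments_determine (R : realType) (d1 d2 : measure_display)
  (T1 : measurableType d1) (T2 : measurableType d2)
  (m1 : {measure set T1 -> \bar R}) (m2 : {measure set T2 -> \bar R})
  (D1 : set T1) (D2 : set T2) (v1 g1 : T1 -> R) (v2 g2 : T2 -> R) (a b : R) :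
  weighted m1 D1 v1 g1 -> weighted m2 D2 v2 g2 ->
  (forall k, \int[m1]_(x in D1) (v1 x ^+ k * g1 x) =
             \int[m2]_(x in D2) (v2 x ^+ k * g2 x)) ->
  0 <= a -> a < b -> b <= 1 ->
  \int[m1]_(x in D1) ((v1 x <= a)%R%:R * g1 x) <=
  \int[m2]_(x in D2) ((v2 x < b)%R%:R * g2 x).
Proof.
move=> w1 w2 mom a0 ab b1.
have [mD1 mv1 v101 ig1 g10] := w1; have [mD2 mv2 v201 ig2 g20] := w2.
set A := \int[m1]_(x in D1) _; set B := \int[m2]_(x in D2) _.
set G := \int[m2]_(x in D2) g2 x.
have bool01 (c : bool) : `|c%:R| <= 1 :> R by case: c; rewrite ?normr1 ?normr0.
have mA : measurable_fun D1 (fun x => (v1 x <= a)%R%:R : R).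
  have := measurable_fun_ler mv1 (measurable_cst a).
  move=> mb; apply: (measurableT_comp (f := fun c : bool => c%:R : R)) mb.
  by [].
have mB : measurable_fun D2 (fun x => (v2 x < b)%R%:R : R).
  have := measurable_fun_ltr mv2 (measurable_cst b).
  move=> mb; apply: (measurableT_comp (f := fun c : bool => c%:R : R)) mb.
  by [].
have iA : m1.-integrable D1 (EFin \o (fun x => (v1 x <= a)%R%:R * g1 x)).
  exact: (integrable_weighted w1 mA (fun x _ => bool01 _)).
have iB : m2.-integrable D2 (EFin \o (fun x => (v2 x < b)%R%:R * g2 x)).
  exact: (integrable_weighted w2 mB (fun x _ => bool01 _)).
have key e : 0 < e -> (1 - e) * A <= B + e * G.
  move=> e0; have [f ff] := poly_separation a0 ab b1 e0.
  apply: (@le_trans _ _ (\int[m1]_(x in D1) (f.[v1 x] * g1 x))).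
    rewrite /A -RintegralZl //; apply: le_Rintegral => //.
    - rewrite (_ : EFin \o _ =
        fun x : T1 => ((1 - e)%:E * ((v1 x <= a)%R%:R * g1 x)%:E)%E) //.
      exact: (integrableZl mD1 _ iA).
    - exact: integrable_horner.
    - move=> x Dx; rewrite mulrA ler_wpM2r ?g10 //.
      have [/andP[f0 _] fa _] := ff _ (v101 _ Dx).
      by case: (boolP (v1 x <= a)) => [/fa|]; rewrite ?mulr1 ?mulr0.
  rewrite (integral_horner w1); under eq_bigr do rewrite mom.
  rewrite -(integral_horner w2) /B /G -RintegralZl // -RintegralD //; last first.
    rewrite (_ : EFin \o _ = fun x : T2 => (e%:E * (g2 x)%:E)%E) //.
    exact: (integrableZl mD2 _ ig2).
  apply: le_Rintegral => //.
  - exact: integrable_horner.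
  - rewrite (_ : EFin \o _ = fun x : T2 => (((v2 x < b)%R%:R * g2 x)%:E +
      (e * g2 x)%:E)%E) //.
    apply: integrableD => //.
    rewrite (_ : (fun x => (e * g2 x)%:E) =
      fun x : T2 => (e%:E * (g2 x)%:E)%E) //.
    exact: (integrableZl mD2 _ ig2).
  - move=> x Dx; rewrite -mulrDl ler_wpM2r ?g20 //.
    have [/andP[_ f1] _ fb] := ff _ (v201 _ Dx).
    case: ltP => [_|/fb]; last by rewrite add0r.
    by rewrite (le_trans f1) // lerDl ltW.
have G0 : 0 <= G by apply: Rintegral_ge0.
have A0 : 0 <= A by apply: Rintegral_ge0 => x Dx; rewrite mulr_ge0 ?g10.
rewrite leNgt; apply/negP => BA.
(* With this [e], [key] would give [A - B <= e (A + G) < (A - B) / 2]; the added 1 keeps the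
   denominator positive. *)
pose e := (A - B) / (2 * (A + G + 1)).
have AG : 0 < 2 * (A + G + 1) by lra.
have e0 : 0 < e by rewrite divr_gt0 // subr_gt0.
have eE : e * (2 * (A + G + 1)) = A - B by rewrite /e mulfVK // gt_eqF.
by have := key e e0; nra.
Qed.

(** * Integrals of powers of sine and cosine *)

Section Wallis.
Context {R : realType}.
Local Notation leb := (@lebesgue_measure R).

Lemma is_derive_pow (f : R -> R) (x df : R) n : is_derive x 1 f df ->
  is_derive x 1 (fun t => f t ^+ n.+1) (n.+1%:R * f x ^+ n * df).
Proof.
move=> fd; have -> : (fun t => f t ^+ n.+1) = f ^+ n.+1.
  by apply/funext => t; rewrite exprfctE.
by apply: is_derive_eq; rewrite -mulr_natl.
Qed.

Lemma is_derive_mul (f g : R -> R) (x df dg : R) :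
  is_derive x 1 f df -> is_derive x 1 g dg ->
  is_derive x 1 (fun t => f t * g t) (f x * dg + g x * df).
Proof. by move=> fd gd; exact: is_deriveM. Qed.

Lemma is_derive_inv (f : R -> R) (x df : R) : f x != 0 -> is_derive x 1 f df ->
  is_derive x 1 (fun t => (f t)^-1) (- (f x ^- 2) * df).
Proof. by move=> f0 fd; apply: is_derive_eq. Qed.

Lemma Rintegral_FTC (f F : R -> R) (a b : R) : a < b ->
  (forall x, a <= x <= b -> is_derive x 1 F (f x)) ->
  (forall x, a <= x <= b -> {for x, continuous f}) ->
  \int[leb]_(x in `[a, b]) f x = F b - F a.
Proof.
move=> ab dF cf; have cF x : a <= x <= b -> {for x, continuous F}.
  move=> xab; apply/differentiable_continuous/derivable1_diffP.
  by have [] := dF x xab.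
rewrite /Rintegral (@continuous_FTC2 _ f F) //.
- apply: continuous_in_subspaceT => x; rewrite inE /= in_itv /=; exact: cf.
- split.
  + move=> x; rewrite in_itv /= => /andP[ax xb].
    by have [] := dF x; rewrite // !ltW.
  + by apply: cvg_at_right_filter; apply: cF; rewrite lexx ltW.
  + by apply: cvg_at_left_filter; apply: cF; rewrite lexx ltW.
- move=> x; rewrite in_itv /= => /andP[ax xb].
  by rewrite derive1E; have [|_ ->] := dF x; rewrite // !ltW.
Qed.

Lemma continuous_sin_cos (n m : nat) :
  continuous (fun x : R => sin x ^+ n * cos x ^+ m).
Proof.
move=> x; apply: cvgM.
  apply: (@continuous_comp _ _ _ (@sin R) (fun t => t ^+ n)).
    exact: continuous_sin.
  exact: exprn_continuous.
apply: (@continuous_comp _ _ _ (@cos R) (fun t => t ^+ m)).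
  exact: continuous_cos.
exact: exprn_continuous.
Qed.

Lemma integrable_sin_cos n m a b :
  leb.-integrable `[a, b] (EFin \o (fun x => sin x ^+ n * cos x ^+ m)).
Proof.
apply: continuous_compact_integrable; first exact: segment_compact.
exact: continuous_subspaceT (@continuous_sin_cos n m).
Qed.

Definition sincos_int n m : R :=
  \int[leb]_(x in `[0, pi / 2]) (sin x ^+ n * cos x ^+ m).

(** Integration by parts: the two sides are the two terms of the derivative of
    [sin^(n+1) cos^(m+1)], which vanishes at 0 and at [pi / 2]. *)
Lemma sincos_int_rec n m :
  n.+1%:R * sincos_int n m.+2 = m.+1%:R * sincos_int n.+2 m.
Proof.
have p0 : 0 < pi / 2 :> R by rewrite divr_gt0 // pi_gt0.
have dF (x : R) : is_derive x 1 (fun t => sin t ^+ n.+1 * cos t ^+ m.+1)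
    (n.+1%:R * (sin x ^+ n * cos x ^+ m.+2) -
     m.+1%:R * (sin x ^+ n.+2 * cos x ^+ m)).
  have := is_derive_mul (is_derive_pow n (is_derive_sin x))
    (is_derive_pow m (is_derive_cos x)).
  by move=> /is_derive_eq; apply; rewrite !exprS; ring.
have int1 c k l : leb.-integrable `[0, pi / 2]
    (EFin \o (fun x => c * (sin x ^+ k * cos x ^+ l))).
  rewrite (_ : EFin \o _ = fun x : R =>
    (c%:E * (sin x ^+ k * cos x ^+ l)%:E)%E) //.
  exact: (integrableZl _ _ (integrable_sin_cos _ _ _ _)).
have := Rintegral_FTC p0 (fun x _ => dF x).
rewrite sin_pihalf cos_pihalf sin0 !exprS !mul0r mulr0 subrr.
rewrite RintegralB //= !RintegralZl //; try exact: integrable_sin_cos.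
move=> H; apply/eqP; rewrite -subr_eq0; apply/eqP; apply: H => x _.
apply: cvgB; apply: cvgM; try exact: cvg_cst; exact: continuous_sin_cos.
Qed.

Lemma sincos_int_split n m :
  sincos_int n m = sincos_int n.+2 m + sincos_int n m.+2.
Proof.
rewrite /sincos_int -RintegralD //; try exact: integrable_sin_cos.
apply: eq_Rintegral => x _; rewrite -[LHS]mulr1 -(cos2Dsin2 x) !exprS; ring.
Qed.

(** The recursion of [sphere_moment_rec] with [p = m + 2]. *)
Lemma sincos_int_ratio k m :
  (2 * k.+1 - 1)%:R * (sincos_int (2 * k) m - sincos_int (2 * k.+1) m) =
  m.+1%:R * sincos_int (2 * k.+1) m.
Proof.
rewrite mulnS add2n [in LHS]sincos_int_split addrC addKr subn1 /=.
exact: sincos_int_rec.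
Qed.

Definition wallis m := sincos_int 0 m.

Lemma wallis0 : wallis 0 = pi / 2.
Proof.
rewrite /wallis /sincos_int; under eq_Rintegral do rewrite !expr0 mulr1.
rewrite Rintegral_cst // mul1r.
transitivity (fine (@lebesgue_measure R [set` `[0, pi / 2]])) => //.
rewrite lebesgue_measure_itv /= lte_fin.
by rewrite divr_gt0 ?pi_gt0 //= subr0.
Qed.

Lemma wallis1 : wallis 1 = 1.
Proof.
rewrite /wallis /sincos_int; under eq_Rintegral do rewrite expr0 mul1r expr1.
rewrite (Rintegral_FTC (F := sin)).
- by rewrite sin_pihalf sin0 subr0.
- by rewrite divr_gt0 // pi_gt0.
- by move=> x _; exact: continuous_cos.
Qed.

Lemma wallisSS m : m.+2%:R * wallis m.+2 = m.+1%:R * wallis m.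
Proof.
rewrite /wallis [in RHS]sincos_int_split mulrDr -sincos_int_rec.
by rewrite -[in LHS]natr1 mulrDl addrC.
Qed.

(** By [wallisSS] the product does not depend on [m]. Together with monotonicity it fixes the size
    of each factor. *)
Lemma wallis_prod m : m.+1%:R * wallis m * wallis m.+1 = pi / 2.
Proof.
elim: m => [|m IH]; first by rewrite wallis0 wallis1 mul1r mulr1.
by rewrite mulrAC wallisSS -IH.
Qed.

Lemma cos_ge0_itv (x : R) : 0 <= x <= pi / 2 -> 0 <= cos x.
Proof.
move=> /andP[x0 xp]; apply: cos_ge0_pihalf; rewrite xp andbT.
by rewrite (le_trans _ x0) // oppr_le0 divr_ge0 // pi_ge0.
Qed.

Lemma wallis_le m : wallis m.+1 <= wallis m.
Proof.
apply: le_Rintegral => //; try exact: integrable_sin_cos.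
move=> x; rewrite /= in_itv /= => /cos_ge0_itv c0.
by rewrite !expr0 !mul1r exprS ler_piMl ?exprn_ge0 // cos_le1.
Qed.

Lemma wallis_gt0 m : 0 < wallis m.
Proof.
have := wallis_prod m; rewrite lt_neqAle => H; apply/andP; split.
  apply/eqP => w0; move: H; rewrite -w0 mulr0 mul0r => /esym/eqP.
  by rewrite gt_eqF // divr_gt0 // pi_gt0.
apply: Rintegral_ge0 => x; rewrite /= in_itv /= => /cos_ge0_itv c0.
by rewrite expr0 mul1r exprn_ge0.
Qed.

Definition cos_tail m (th : R) : R := \int[leb]_(x in `[th, pi / 2]) cos x ^+ m.

Lemma integrable_cos m a b : leb.-integrable `[a, b] (EFin \o (fun x => cos x ^+ m)).
Proof.
have := integrable_sin_cos 0 m a b; congr (leb.-integrable _ _).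
by apply/funext => x /=; rewrite expr0 mul1r.
Qed.

(* [- cos^(m+1) / sin] has derivative [(m+1) cos^m + cos^(m+2) / sin^2]. *)
Lemma cos_tail_bounds m th : 0 < th -> th < pi / 2 ->
  m.+1%:R * cos_tail m th <= cos th ^+ m.+1 / sin th <=
  m.+1%:R * cos_tail m th * (1 + (m.+1%:R * sin th ^+ 2)^-1).
Proof.
move=> th0 thp; set M : R := m.+1%:R; have thpi : th <= pi.
  by rewrite (le_trans (ltW thp)) // ler_pdivrMr // ler_peMr ?pi_ge0 // ler1n.
have sth x : th <= x <= pi / 2 -> 0 < sin x.
  move=> /andP[tx xp]; apply: sin_gt0_pi; rewrite (lt_le_trans th0 tx) /=.
  by rewrite (le_lt_trans xp) // ltr_pdivrMr // ltr_pMr ?pi_gt0 // ltr1n.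
have sth0 : 0 < sin th by apply: sth; rewrite lexx ltW.
pose f x : R := M * cos x ^+ m + cos x ^+ m.+2 * sin x ^- 2.
have dF x : th <= x <= pi / 2 ->
    is_derive x 1 (fun t => - (cos t ^+ m.+1 * (sin t)^-1)) (f x).
  move=> /sth sx; have sx0 : sin x != 0 by rewrite gt_eqF.
  have := is_derive_mul (is_derive_pow m (is_derive_cos x))
    (is_derive_inv sx0 (is_derive_sin x)).
  move=> /is_deriveN /is_derive_eq; apply; rewrite /f /M !exprS; field.
  exact: sx0.
have cf x : th <= x <= pi / 2 -> {for x, continuous f}.
  move=> /sth sx; have sx0 : sin x != 0 by rewrite gt_eqF.
  have cc n : {for x, continuous (fun t : R => cos t ^+ n)}.
    apply: (@continuous_comp _ _ _ (@cos R) (fun t => t ^+ n)).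
      exact: continuous_cos.
    exact: exprn_continuous.
  apply: cvgD; apply: cvgM => //; first exact: cvg_cst.
  - exact: cc.
  - exact: cc.
  - apply: cvgV; first by rewrite expf_neq0.
    apply: (@continuous_comp _ _ _ (@sin R) (fun t => t ^+ 2)).
      exact: continuous_sin.
    exact: exprn_continuous.
have FTC := Rintegral_FTC thp dF cf.
have {FTC} intf : \int[leb]_(x in `[th, pi / 2]) f x = cos th ^+ m.+1 / sin th.
  by rewrite FTC cos_pihalf expr0n mul0r oppr0 sub0r opprK.
have iM c : leb.-integrable `[th, pi / 2] (EFin \o (fun x => c * cos x ^+ m)).
  rewrite (_ : EFin \o _ = fun x : R => (c%:E * (cos x ^+ m)%:E)%E) //.
  exact: (integrableZl _ _ (integrable_cos _ _ _)).
have if_ : leb.-integrable `[th, pi / 2] (EFin \o f).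
  apply: continuous_compact_integrable; first exact: segment_compact.
  apply: continuous_in_subspaceT => x; rewrite inE /= in_itv /=; exact: cf.
have M0 : 0 < M by rewrite ltr0n.
rewrite -intf /cos_tail -!RintegralZl //; last exact: integrable_cos.
rewrite -RintegralZr //.
have iMc c : leb.-integrable `[th, pi / 2] (EFin \o (fun x => M * cos x ^+ m * c)).
  have := iM (M * c); congr (leb.-integrable _ _); apply/funext => x /=.
  by rewrite mulrAC.
have c0 x : th <= x <= pi / 2 -> 0 <= cos x.
  by move=> /andP[tx xp]; rewrite cos_ge0_itv // xp (le_trans (ltW th0) tx).
apply/andP; split; apply: le_Rintegral => // x; rewrite /= in_itv /= => txp.
  by rewrite /f lerDl mulr_ge0 ?invr_ge0 ?exprn_ge0 ?(ltW (sth x txp)) ?c0.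
have sx := sth x txp; have cx := c0 x txp.
have cxt : cos x <= cos th.
  case/andP: txp => tx xp; have xpi : x <= pi.
    by rewrite (le_trans xp) // ler_pdivrMr // ler_peMr ?pi_ge0 // ler1n.
  move: tx; rewrite le_eqVlt => /orP[/eqP ->//|tx].
  by apply: ltW; rewrite ltr_cos // in_itv /= ?thpi ?xpi ltW // (lt_trans th0).
have sxt : sin th ^+ 2 <= sin x ^+ 2.
  have := cos2Dsin2 x; have := cos2Dsin2 th; nra.
(* The excess [cos^(m+2) / sin^2] is at most [cos^m / sin^2 th], as the squared sine is least at
   [th]; this produces the relative error [1 / (M sin^2 th)]. *)
rewrite /f mulrDr mulr1 lerD2l [X in _ <= _ * X]invfM [leRHS]mulrACA mulfV ?gt_eqF // mul1r.
apply: ler_pM.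
- exact: exprn_ge0.
- by rewrite invr_ge0 exprn_ge0 // ltW.
- rewrite -addn2 exprD ler_piMr ?exprn_ge0 //.
- by rewrite lef_pV2 // posrE exprn_gt0.
Qed.

End Wallis.

(** * Cap probabilities *)

Lemma measurable_ind_le (R : realType) d (T : measurableType d) (D : set T)
  (v : T -> R) a : measurable_fun D v ->
  measurable_fun D (fun x => (v x <= a)%R%:R : R).
Proof.
move=> mv; have mb := measurable_fun_ler mv (measurable_cst a).
exact: (measurableT_comp (f := fun c : bool => c%:R : R)) mb.
Qed.

Lemma measurable_ind_lt (R : realType) d (T : measurableType d) (D : set T)
  (v : T -> R) a : measurable_fun D v ->
  measurable_fun D (fun x => (v x < a)%R%:R : R).
Proof.
move=> mv; have mb := measurable_fun_ltr mv (measurable_cst a).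
exact: (measurableT_comp (f := fun c : bool => c%:R : R)) mb.
Qed.

Section CapProbability.
Context (R : realType) (m : nat).
Local Notation p := m.+2.
Local Notation leb := (@lebesgue_measure R).
Context (mu : probability (p.-tuple R) R).
Hypothesis unif : uniform_on_sphere mu.

Let S := [set y : p.-tuple R | dotv y y = 1].
Let v (y : p.-tuple R) : R := tnth y ord0 ^+ 2.
Let H := wallis (R := R) m.

Let mv : measurable_fun setT v.
Proof. by apply: measurable_funX; exact: measurable_tnth. Qed.

Let mS : measurable S. Proof. exact: measurable_dotv1. Qed.

Let integrable_cstS c : mu.-integrable S (EFin \o (fun=> c)).
Proof.
apply: measurable_bounded_integrable => //.
- by rewrite ltey_eq fin_num_measure.
- exists `|c|; split; first exact: num_real.
  by move=> x cx y Sy; exact: ltW.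
Qed.

Let integrable_bounded1 (h : p.-tuple R -> R) : measurable_fun S h ->
  (forall y, S y -> `|h y| <= 1) -> mu.-integrable S (EFin \o h).
Proof.
move=> mh h1; apply: measurable_bounded_integrable => //.
  by rewrite ltey_eq fin_num_measure.
exists 1; split; first exact: num_real.
by move=> x x1 y Sy; exact: le_trans (h1 y Sy) (ltW x1).
Qed.

(** The constant weight [H] gives the sphere the same total mass as the arc with weight [cos^m]. *)
Let weighted_sphere : weighted mu S v (fun=> H).
Proof.
split=> //; first exact: measurable_funTS.
- move=> y Sy; rewrite sqr_ge0 /= /v -real_normK ?num_real //.
  by rewrite exprn_ile1 // sphere_tnth_le1.
- by move=> _ _; exact/ltW/wallis_gt0.
Qed.

Let w (x : R) : R := sin x ^+ 2.

Let weighted_arc : weighted leb `[0, pi / 2] w (fun x => cos x ^+ m).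
Proof.
split => //.
- apply: measurable_funTS; apply: measurable_funX.
  exact: continuous_measurable_fun (@continuous_sin R).
- move=> x _; rewrite sqr_ge0 /= /w.
  by have := cos2Dsin2 x; have := sqr_ge0 (cos x); lra.
- exact: integrable_cos.
- by move=> x; rewrite /= in_itv /= => /cos_ge0_itv c0; rewrite exprn_ge0.
Qed.

(** Both sides equal [H] at [k = 0] and obey the same first-order recursion, whose leading
    coefficient [A + B] is nonzero. *)
Let moments_eq k : \int[mu]_(y in S) (v y ^+ k * H) =
  \int[leb]_(x in `[0, pi / 2]) (w x ^+ k * cos x ^+ m).
Proof.
have -> : \int[mu]_(y in S) (v y ^+ k * H) = sphere_moment mu ord0 k * H.
  have iX : mu.-integrable S (EFin \o (fun y => v y ^+ k)).
    apply: integrable_bounded1.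
      by apply: measurable_funX; exact: measurable_funTS.
    move=> y Sy; have [_ _ /(_ _ Sy) /andP[v0 v1] _ _] := weighted_sphere.
    by rewrite normrX (ger0_norm v0) exprn_ile1.
  rewrite RintegralZr //; congr (_ * _).
  by apply: eq_Rintegral => y _; rewrite /v -exprM.
transitivity (sincos_int (R := R) (2 * k) m); last first.
  by apply: eq_Rintegral => x _; rewrite /w -exprM.
elim: k => [|k IH]; first by rewrite sphere_moment0 // mul1r muln0.
have := sphere_moment_rec unif ord0 k; have := sincos_int_ratio (R := R) k m.
rewrite -IH /= -/H.
set A := (2 * k.+1 - 1)%:R; set B := m.+1%:R; set c' := sphere_moment mu ord0 k.+1.
set s' := sincos_int _ _ => r1 r2.
have AB : A + B != 0 by rewrite -natrD pnatr_eq0 addnS.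
apply: (mulfI AB).
have -> : (A + B) * s' = A * (sphere_moment mu ord0 k * H).
  by rewrite mulrDl -r1; ring.
by rewrite [LHS]mulrA (_ : (A + B) * c' = A * sphere_moment mu ord0 k) ?mulrA //
  mulrDl -r2; ring.
Qed.

Let q s := fine (mu [set y | s < v y]).

Let mgt s : measurable [set y | s < v y].
Proof.
have := mv measurableT (measurable_itv `]s, +oo[); rewrite setTI.
by congr (measurable _); apply/seteqP; split=> y /=; rewrite in_itv /= andbT.
Qed.

Let muS A : measurable A -> mu (A `&` S) = mu A.
Proof.
move=> mA; have SC : mu (~` S) = 0%E.
  by rewrite probability_setC // (sphere_dotv unif) subee.
have AS : mu (A `\` S) = 0%E.
  apply/eqP; rewrite eq_le measure_ge0 andbT -SC le_measure ?inE //.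
  - exact: measurableD.
  - exact: measurableC.
apply/esym; transitivity (mu (A `\` S) + mu (A `&` S))%E.
  exact: measureDI.
by rewrite AS add0e.
Qed.

Let int_le a : \int[mu]_(y in S) ((v y <= a)%R%:R * H) = (1 - q a) * H.
Proof.
have mle : measurable [set y | v y <= a].
  have := measurableC (mgt a); congr (measurable _).
  by apply/seteqP; split=> y /=; rewrite leNgt => /negP.
have -> : 1 - q a = fine (mu [set y | v y <= a]).
  have -> : [set y | v y <= a] = ~` [set y | a < v y].
    by apply/seteqP; split=> y /=; rewrite leNgt => /negP.
  rewrite probability_setC // fineB //; first by rewrite fin_num_measure.
rewrite RintegralZr //.
  congr (_ * _); rewrite /Rintegral; congr fine.
  rewrite -(muS mle) -integral_indic //; apply: eq_integral => y _.
  by rewrite indicE mem_setE.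
apply: integrable_bounded1.
  by apply: measurable_ind_le; exact: measurable_funTS.
by move=> y _; case: (v y <= a); rewrite ?normr1 ?normr0.
Qed.

Let cos_integrable_ind (h : R -> R) : measurable_fun `[0, pi / 2] h ->
  (forall x, `|h x| <= 1) ->
  leb.-integrable `[0, pi / 2] (EFin \o (fun x => h x * cos x ^+ m)).
Proof. by move=> mh h1; apply: (integrable_weighted weighted_arc mh). Qed.

Let wallisE : H = \int[leb]_(x in `[0, pi / 2]) (cos x ^+ m).
Proof. by apply: eq_Rintegral => x _; rewrite expr0 mul1r. Qed.

(** On [[0, pi / 2]] cosines are nonnegative and decreasing, so [b <= sin^2 x] means
    [cos x <= sqrt (1 - b)], that is [x >= th]. *)
Let int_arc b : 0 < b -> b < 1 ->
  \int[leb]_(x in `[0, pi / 2]) ((w x < b)%R%:R * cos x ^+ m) =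
  H - cos_tail m (acos (Num.sqrt (1 - b))).
Proof.
move=> b0 b1; set th := acos _; have b1' : 0 <= 1 - b by lra.
have sb : -1 <= Num.sqrt (1 - b) <= 1.
  rewrite (le_trans _ (sqrtr_ge0 _)) ?lerN10 //=.
  by rewrite -[leRHS]sqrtr1 ler_wsqrtr // lerBlDr lerDl ltW.
have cth : cos th = Num.sqrt (1 - b) by rewrite acosK // in_itv.
have th0 : 0 <= th by exact: acos_ge0.
have thpi : th <= pi by exact: acos_lepi.
have mw : measurable_fun `[0, pi / 2] w by case: weighted_arc.
have i1 : leb.-integrable `[0, pi / 2]
    (EFin \o (fun x => (w x < b)%R%:R * cos x ^+ m)).
  apply: cos_integrable_ind; first exact: measurable_ind_lt.
  by move=> x; case: (w x < b); rewrite ?normr1 ?normr0.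
have bE : (fun x => (b <= w x)%R%:R : R) = (fun x => 1 - (w x < b)%R%:R).
  by apply/funext => x; case: leP => _; rewrite ?subr0 ?subrr.
have i2 : leb.-integrable `[0, pi / 2]
    (EFin \o (fun x => (b <= w x)%R%:R * cos x ^+ m)).
  apply: (cos_integrable_ind (h := fun x => (b <= w x)%R%:R)).
    rewrite bE; apply: measurable_funB; first exact: measurable_cst.
    exact: measurable_ind_lt.
  by move=> x; case: (b <= w x); rewrite ?normr1 ?normr0.
have tailE : cos_tail m th =
    \int[leb]_(x in `[0, pi / 2]) ((b <= w x)%R%:R * cos x ^+ m).
  have sub : `[th, pi / 2] `<=` `[0, pi / 2].
    move=> x; rewrite /= !in_itv /= => /andP[tx ->]; rewrite andbT.
    exact: le_trans tx.
  rewrite /cos_tail -(setIidr sub) Rintegral_mkcondr.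
  apply: eq_Rintegral => x; rewrite inE /= in_itv /= => /andP[x0 xp].
  have xpi : x <= pi.
    by rewrite (le_trans xp) // ler_pdivrMr // ler_peMr ?pi_ge0 // ler1n.
  have -> : (b <= w x) = (th <= x).
    have cx : 0 <= cos x by rewrite cos_ge0_itv // x0.
    rewrite [RHS]leNgt -ltr_cos ?in_itv /= ?th0 ?x0 // -leNgt cth.
    rewrite -[RHS](@ler_pXn2r _ 2) ?nnegrE ?sqrtr_ge0 // sqr_sqrtr //.
    by rewrite lerBrDr -(cos2Dsin2 x) lerD2l.
  rewrite patchE mem_setE in_itv /= xp andbT.
  by case: (th <= x); rewrite ?mul1r ?mul0r.
rewrite tailE wallisE; apply/eqP; rewrite eq_sym subr_eq -RintegralD //.
apply/eqP; apply: eq_Rintegral => x _; rewrite -mulrDl.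
by case: leP => _; rewrite ?add0r ?addr0 mul1r.
Qed.

Let q_ge0 s : 0 <= q s. Proof. exact: fine_ge0. Qed.

Let tail_le_cap a b : 0 <= a -> a < b -> b < 1 ->
  cos_tail m (acos (Num.sqrt (1 - b))) <= H * q a.
Proof.
move=> a0 ab b1.
have := moments_determine weighted_sphere weighted_arc moments_eq a0 ab (ltW b1).
rewrite int_le int_arc //; last exact: le_lt_trans ab.
by rewrite mulrBl mul1r lerD2l lerN2 mulrC.
Qed.

Let cap_le_tail a b : 0 < a -> a < b -> b <= 1 ->
  H * q b <= cos_tail m (acos (Num.sqrt (1 - a))).
Proof.
move=> a0 ab b1; have a1 : a < 1 by exact: lt_le_trans b1.
have := moments_determine weighted_arc weighted_sphere
  (fun k => esym (moments_eq k)) (ltW a0) ab b1.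
set I1 := \int[_]_(_ in _) _; set I2 := \int[_]_(_ in _) _ => I12.
have : H - cos_tail m (acos (Num.sqrt (1 - a))) <= I1.
  rewrite -int_arc //; apply: le_Rintegral => //.
  - apply: cos_integrable_ind; last first.
      by move=> x; case: (w x < a); rewrite ?normr1 ?normr0.
    by apply: measurable_ind_lt; case: weighted_arc.
  - apply: cos_integrable_ind; last first.
      by move=> x; case: (w x <= a); rewrite ?normr1 ?normr0.
    by apply: measurable_ind_le; case: weighted_arc.
  - move=> x; rewrite /= in_itv /= => /cos_ge0_itv c0.
    by rewrite ler_wpM2r ?exprn_ge0 // ler_nat; case: ltgtP.
have : I2 <= (1 - q b) * H.
  rewrite -int_le; apply: le_Rintegral => //.
  - apply: (integrable_weighted weighted_sphere (c := 1)); last first.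
      by move=> x _; case: (v x < b); rewrite ?normr1 ?normr0.
    by apply: measurable_ind_lt; exact: measurable_funTS.
  - apply: (integrable_weighted weighted_sphere (c := 1)); last first.
      by move=> x _; case: (v x <= b); rewrite ?normr1 ?normr0.
    by apply: measurable_ind_le; exact: measurable_funTS.
  - move=> x _; rewrite ler_wpM2r ?(ltW (wallis_gt0 _)) // ler_nat.
    by case: ltgtP.
by rewrite mulrBl mul1r (mulrC (q b)); lra.
Qed.

Let tail_bounds (a : R) : 0 < a -> a < 1 ->
  let t : R := cos_tail m (acos (Num.sqrt (1 - a))) in
  (m.+1%:R * t * Num.sqrt a <= Num.sqrt (1 - a) ^+ m.+1) /\
  (Num.sqrt (1 - a) ^+ m.+1 <=
     m.+1%:R * t * Num.sqrt a * (1 + (m.+1%:R * a)^-1)).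
Proof.
move=> a0 a1 /=; set th := acos _.
have sa0 : 0 < Num.sqrt (1 - a) by rewrite sqrtr_gt0; lra.
have sa1 : Num.sqrt (1 - a) < 1 by rewrite -[ltRHS]sqrtr1 ltr_sqrt //; lra.
have sb : -1 <= Num.sqrt (1 - a) <= 1 by rewrite (ltW sa1) andbT; lra.
have cth : cos th = Num.sqrt (1 - a) by rewrite acosK // in_itv.
have sth : sin th = Num.sqrt a.
  by rewrite sin_acos // sqr_sqrtr ?subKr //; lra.
have th0 : 0 < th by rewrite acos_gt0 // sa1 andbT; lra.
have thp : th < pi / 2.
  rewrite -ltr_cos ?cos_pihalf ?cth // in_itv /=; first by rewrite acos_ge0 ?acos_lepi.
  by rewrite divr_ge0 ?pi_ge0 //= ler_pdivrMr // ler_peMr ?pi_ge0 // ler1n.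
have := cos_tail_bounds m th0 thp; rewrite cth sth sqr_sqrtr ?(ltW a0) //.
have ra : 0 < Num.sqrt a by rewrite sqrtr_gt0.
move=> /andP[]; rewrite ler_pdivlMr // ler_pdivrMr // => lo up.
by split=> //; rewrite mulrAC.
Qed.

(** The cap at [s] is compared with arc tails at other levels [a]: the first bound lets [a] increase
    to [s], the second lets it decrease to [s]. Only the explicit bounds vary with [a], and they are
    continuous. *)
Lemma cap_probability_bounds (s : R) : 0 < s -> s < 1 ->
  let Q : R := wallis m * fine (mu [set y | s < tnth y ord0 ^+ 2]) in
  (m.+1%:R * Q * Num.sqrt s <= Num.sqrt (1 - s) ^+ m.+1) /\
  (Num.sqrt (1 - s) ^+ m.+1 <=
     m.+1%:R * Q * Num.sqrt s * (1 + (m.+1%:R * s)^-1)).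
Proof.
move=> s0 s1 Q; have QE : Q = H * q s by [].
have Q0 : 0 <= Q by rewrite QE mulr_ge0 // ltW // wallis_gt0.
have csqrt : {for s, continuous (fun a : R => Num.sqrt a)}.
  exact: sqrt_continuous.
have cpow : {for s, continuous (fun a : R => Num.sqrt (1 - a) ^+ m.+1)}.
  apply: (@continuous_comp _ _ _ (fun a : R => Num.sqrt (1 - a))
    (fun t => t ^+ m.+1)); last exact: exprn_continuous.
  apply: (@continuous_comp _ _ _ (fun a : R => 1 - a) Num.sqrt).
    by apply: cvgB; [exact: cvg_cst|exact: cvg_id].
  exact: sqrt_continuous.
split.
- pose f a := Num.sqrt (1 - a) ^+ m.+1 - m.+1%:R * Q * Num.sqrt a.
  have cf : f a @[a --> s^'-] --> f s.
    apply: cvg_at_left_filter; apply: cvgB; first exact: cpow.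
    by apply: cvgM; [exact: cvg_cst|exact: csqrt].
  suff : 0 <= f s by rewrite subr_ge0.
  apply: (cvgr_to_ge cf); near=> a; rewrite /f subr_ge0.
  have a0 : 0 < a by near: a; exact: nbhs_left_gt.
  have as_ : a < s by near: a; exact: nbhs_left_lt.
  have [up _] := tail_bounds a0 (lt_trans as_ s1); apply: le_trans up.
  by rewrite ler_wpM2r ?sqrtr_ge0 // ler_wpM2l // cap_le_tail // ltW.
- pose f a := m.+1%:R * Q * Num.sqrt a * (1 + (m.+1%:R * a)^-1) -
    Num.sqrt (1 - a) ^+ m.+1.
  have cf : f a @[a --> s^'+] --> f s.
    apply: cvg_at_right_filter; apply: cvgB; last exact: cpow.
    apply: cvgM; first by apply: cvgM; [exact: cvg_cst|exact: csqrt].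
    apply: cvgD; first exact: cvg_cst.
    apply: cvgV; first by rewrite mulf_neq0 // ?gt_eqF.
    by apply: cvgM; [exact: cvg_cst|exact: cvg_id].
  suff : 0 <= f s by rewrite subr_ge0.
  apply: (cvgr_to_ge cf); near=> a; rewrite /f subr_ge0.
  have as_ : s < a by near: a; exact: nbhs_right_gt.
  have a1 : a < 1 by near: a; exact: nbhs_right_lt.
  have a0 := lt_trans s0 as_.
  have [_ lo] := tail_bounds a0 a1; apply: (le_trans lo).
  rewrite ler_wpM2r //.
    by rewrite addr_ge0 // invr_ge0 mulr_ge0 // ltW.
  by rewrite ler_wpM2r ?sqrtr_ge0 // ler_wpM2l // tail_le_cap // ltW.
Unshelve. all: by end_near. Qed.

End CapProbability.

(** * Asymptotics *)

Section AsymptoticTools.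
Context {R : realType}.

Lemma squeeze0 (f g : R^nat) : (\forall n \near \oo, `|f n| <= g n) ->
  g n @[n --> \oo] --> 0 -> f n @[n --> \oo] --> 0.
Proof.
move=> fg g0; apply: (@squeeze_cvgr _ _ _ _ (fun n => - g n) g).
- by near=> n; rewrite -ler_norml; near: n.
- by rewrite -[X in _ --> X]oppr0; exact: cvgN.
- exact: g0.
Unshelve. all: by end_near. Qed.

Lemma cvg_sqrt (f : R^nat) l : f n @[n --> \oo] --> l ->
  Num.sqrt (f n) @[n --> \oo] --> Num.sqrt l.
Proof. by move=> fl; apply: (cvg_comp _ _ fl); exact: sqrt_continuous. Qed.

Lemma cvg_expR (f : R^nat) l : f n @[n --> \oo] --> l ->
  expR (f n) @[n --> \oo] --> expR l.
Proof. by move=> fl; apply: (cvg_comp _ _ fl); exact: continuous_expR. Qed.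

Lemma cvg_ln (f : R^nat) (l : R) : 0 < l -> f n @[n --> \oo] --> l ->
  ln (f n) @[n --> \oo] --> ln l.
Proof. by move=> l0 fl; apply: (cvg_comp _ _ fl); exact: continuous_ln. Qed.

Lemma ln1B_approx (u : R) : `|u| <= 2^-1 -> `|ln (1 - u) + u| <= 2 * u ^+ 2.
Proof.
move=> uh; have [u1 u2] : - 2^-1 <= u /\ u <= 2^-1.
  by move: uh; rewrite ler_norml => /andP[].
have d0 : 0 < 1 - u by lra.
have up : ln (1 - u) <= - u by apply: le_ln1Dx; lra.
(* The lower bound is the inequality [ln (1 + z) <= z] applied to the inverse of [1 - u]. *)
have lo : ln (1 - u)^-1 <= u / (1 - u).
  rewrite [X in ln X](_ : _ = 1 + u / (1 - u)); last first.
    by field; rewrite gt_eqF.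
  apply: le_ln1Dx; rewrite ltr_pdivlMr //; lra.
rewrite lnV ?posrE // in lo.
have uE : u / (1 - u) = u + u ^+ 2 / (1 - u) by field; rewrite gt_eqF.
have u2l : u ^+ 2 / (1 - u) <= 2 * u ^+ 2.
  rewrite ler_pdivrMr // mulrAC ler_peMl ?sqr_ge0 //; lra.
have sq := sqr_ge0 u.
by rewrite ler_norml; apply/andP; split; lra.
Qed.

(** With [z] the fourth root of [v], [ln v = 4 ln z <= 4 z]; squaring gives 16. *)
Lemma ln_sqr_le (v : R) : 1 <= v -> ln v ^+ 2 / v <= 16 * (Num.sqrt v)^-1.
Proof.
move=> v1; have v0 : 0 < v by lra.
set s := Num.sqrt v; have s0 : 0 < s by rewrite sqrtr_gt0.
set z := Num.sqrt s; have z0 : 0 < z by rewrite sqrtr_gt0.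
have sE : s = z ^+ 2 by rewrite sqr_sqrtr // ltW.
have vE : v = s ^+ 2 by rewrite sqr_sqrtr // ltW.
have l0 : 0 <= ln v by exact: ln_ge0.
have lE : ln v = 4 * ln z.
  by rewrite [in LHS]vE sE -exprM (lnXn (2 * 2) z0) mulr_natl.
have lz : ln z <= z by apply: ltW; exact: ln_sublinear.
have lv : ln v ^+ 2 <= 16 * s.
  rewrite sE (_ : 16 * z ^+ 2 = (4 * z) ^+ 2); last by ring.
  by rewrite lerXn2r ?nnegrE //; lra.
rewrite ler_pdivrMr // (_ : 16 / s * v = 16 * s) //.
by rewrite [in LHS]vE; field; rewrite gt_eqF.
Qed.

Lemma wallis_cvg (k : nat -> nat) : k n @[n --> \oo] --> \oo ->
  Num.sqrt (k n)%:R * wallis (k n).-1 @[n --> \oo] -->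
  Num.sqrt (pi / 2 : R).
Proof.
move=> /cvgnyPge koo; have k2 : \forall n \near \oo, (2 <= k n)%N by exact: koo.
have -> : (fun n => Num.sqrt (k n)%:R * wallis (k n).-1) =
    (fun n => Num.sqrt ((k n)%:R * wallis (k n).-1 ^+ 2) : R).
  apply/funext => n; rewrite sqrtrM // sqrtr_sqr ger0_norm //.
  exact/ltW/wallis_gt0.
apply: cvg_sqrt; rewrite -[X in _ --> X]addr0.
have -> : (fun n => (k n)%:R * wallis (k n).-1 ^+ 2) =
    (fun n => pi / 2 + ((k n)%:R * wallis (k n).-1 ^+ 2 - pi / 2) : R).
  by apply/funext => n; rewrite addrC subrK.
apply: cvgD; first exact: cvg_cst.
apply: (squeeze0 (g := fun n => pi * (k n)%:R^-1)).
  near=> n; have : (2 <= k n)%N by near: n.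
  case: (k n) => [//|[//|m]] _ /=.
  have Hp := wallis_gt0 (R := R) m.+1.
  have W1 := wallis_prod (R := R) m.+1; have W0 := wallis_prod (R := R) m.
  have L1 := wallis_le (R := R) m.+1; have L0 := wallis_le (R := R) m.
  have m1 : 1 <= m.+1%:R :> R by rewrite ler1n.
  have mE : m.+2%:R = m.+1%:R + 1 :> R by rewrite natr1.
  rewrite mE in W1 *; set M := m.+1%:R in m1 W0 W1 *.
  set h := wallis m.+1 in Hp W0 W1 L1 L0 *.
  (* The two Wallis products around [h] and monotonicity give [M h^2 <= pi / 2 <= (M + 1) h^2]. The
     error is thus at most [h^2], and [(M + 1) h^2 <= 2 M h^2 <= pi]. *)
  have up : M * h ^+ 2 <= pi / 2.
    by rewrite -W0 expr2 mulrA ler_wpM2r ?(ltW Hp) // ler_wpM2l //; lra.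
  have lo : pi / 2 <= (M + 1) * h ^+ 2.
    by rewrite -W1 expr2 mulrA ler_wpM2l // mulr_ge0 ?(ltW Hp) //; lra.
  have h2 : 0 <= h ^+ 2 by exact: sqr_ge0.
  rewrite ger0_norm ?subr_ge0 // ler_pdivlMr; last by lra.
  nra.
rewrite -[X in _ --> X](mulr0 pi); apply: cvgM; first exact: cvg_cst.
apply/gtr0_cvgV0; first by near=> n; rewrite ltr0n; apply: ltnW; near: n.
by apply/cvgrnyP/cvgnyPge.
Unshelve. all: by end_near. Qed.

End AsymptoticTools.

(** * Cap probability along the critical levels *)

Section CapAsymptotics.
Context (R : realType) (p : nat -> nat).
Hypothesis p_ge2 : forall n, (2 <= n)%N -> (2 <= p n)%N.
Hypothesis p_infty : p @ \oo --> \oo.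

Definition sphere_dim n : R := (p n)%:R - 1.
Definition gap n : R := sphere_dim n * (1 - tpar R n (p n) ^+ 2).

Local Notation M := sphere_dim.
Local Notation v := gap.
Local Notation t n := (tpar R n (p n)).

Let near2 : \forall n \near \oo, (2 <= n)%N.
Proof. by exists 2%N. Qed.

Lemma sphere_dimE n : (2 <= n)%N -> M n = (p n).-1%:R.
Proof.
by move=> /p_ge2 p2; rewrite /M -[in LHS](prednK (ltnW p2)) -natr1 addrK.
Qed.

Lemma sphere_dim_ge1 n : (2 <= n)%N -> 1 <= M n.
Proof.
move=> n2; rewrite sphere_dimE // ler1n; have := p_ge2 n2; by case: (p n) => [|[]].
Qed.

Let ln_gt0 n : (2 <= n)%N -> 0 < ln n%:R :> R.
Proof. by move=> n2; rewrite ln_gt0 // ltr1n. Qed.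

Lemma tpar_gt0 n : 0 < t n. Proof. exact: expR_gt0. Qed.

Lemma tpar_lt1 n : (2 <= n)%N -> t n < 1.
Proof.
move=> n2; rewrite -[ltRHS]expR0 ltr_expR oppr_lt0.
by rewrite divr_gt0 ?mulr_gt0 ?ln_gt0 // (lt_le_trans ltr01) ?sphere_dim_ge1.
Qed.

Lemma tpar_sqr_lt1 n : (2 <= n)%N -> t n ^+ 2 < 1.
Proof. by move=> n2; rewrite expr_lt1 // ?tpar_lt1 // ltW // tpar_gt0. Qed.

Lemma gap_gt0 n : (2 <= n)%N -> 0 < v n.
Proof.
move=> n2; apply: mulr_gt0; first exact: lt_le_trans (sphere_dim_ge1 n2).
by rewrite subr_gt0 tpar_sqr_lt1.
Qed.

Lemma gap_le n : (2 <= n)%N -> v n <= M n.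
Proof.
move=> n2; rewrite ler_piMr ?(le_trans ler01) ?sphere_dim_ge1 //.
by rewrite lerBlDr lerDl sqr_ge0.
Qed.

(** The reason for the choice of [t]: this power is the main factor of the cap probability. *)
Lemma tpar_pow n : (2 <= n)%N -> t n ^+ (p n).-1 = n%:R ^- 2.
Proof.
move=> n2; have n0 : 0 < n%:R :> R by rewrite ltr0n (ltn_trans _ n2).
have M0 : M n != 0 by rewrite gt_eqF // (lt_le_trans ltr01) ?sphere_dim_ge1.
rewrite /tpar -expRM_natl -sphere_dimE // mulrN mulrCA mulfV // mulr1.
by rewrite expRN mulrC -[2]/(2%:R) expRM_natr lnK.
Qed.

Let cvg_invM : (M n)^-1 @[n --> \oo] --> 0.
Proof.
apply/gtr0_cvgV0.
  by near=> n; rewrite (lt_le_trans ltr01) // sphere_dim_ge1 //; near: n.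
have /cvgryPge poo : (p n)%:R @[n --> \oo] --> (+oo%R : set_system R).
  exact/cvgrnyP.
apply/cvgryPge => A; near=> n; rewrite /sphere_dim lerBrDr; near: n; exact: poo.
Unshelve. all: by end_near. Qed.

Let cvg_invln : (ln n%:R)^-1 @[n --> \oo] --> (0 : R).
Proof.
apply/gtr0_cvgV0; first by near=> n; rewrite ln_gt0 //; near: n.
have /cvgryPge noo := @cvgr_idn R.
apply/cvgryPge => A; near=> n; have : expR A <= n%:R by near: n; exact: noo.
move=> An; rewrite -(expRK A) ler_ln ?posrE ?expR_gt0 //.
exact: lt_le_trans (expR_gt0 _) An.
Unshelve. all: by end_near. Qed.

(** With [z = 2 ln n / M], [t = exp (- z) <= 1 / (1 + z)], so [1 - t^2 >= 1 - t >= z / (1 + z)].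
    This gives [1 / v <= 1 / (2 ln n) + 1 / M], whatever the size of [z]. *)
Lemma cvg_invgap : (v n)^-1 @[n --> \oo] --> 0.
Proof.
apply: (squeeze0 (g := fun n => 2^-1 * (ln n%:R)^-1 + (M n)^-1)); last first.
  rewrite -[X in _ --> X]addr0 -[X in _ --> X + _](mulr0 2^-1).
  by apply: cvgD => //; apply: cvgM => //; exact: cvg_cst.
near=> n; have n2 : (2 <= n)%N by near: n.
have v0 := gap_gt0 n2; have M1 := sphere_dim_ge1 n2; have L0 := ln_gt0 n2.
have M0 : 0 < M n by lra.
rewrite ger0_norm ?invr_ge0 ?(ltW v0) //.
set L := ln n%:R in L0 *; pose z := 2 * L / M n.
have z0 : 0 < z by rewrite divr_gt0 // mulr_gt0.
have t0 := tpar_gt0 n; have t1 := tpar_lt1 n2.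
have tz : t n * (1 + z) <= 1.
  rewrite -[leRHS](mulVf (lt0r_neq0 (expR_gt0 z))) -expRN -/(t n).
  by rewrite ler_wpM2l ?(ltW t0) // expR_ge1Dx.
have Mz : M n * z = 2 * L by rewrite /z mulrCA mulfV ?mulr1 ?gt_eqF.
have vz : 2 * L <= v n * (1 + z).
  rewrite -Mz /gap -mulrA ler_pM2l //; nra.
have -> : 2^-1 / L + (M n)^-1 = (1 + z) / (2 * L).
  by rewrite /z; field; rewrite !gt_eqF.
by rewrite ler_pdivlMr ?mulr_gt0 // mulrC ler_pdivrMr // [leRHS]mulrC.
Unshelve. all: by end_near. Qed.

Variables (c : R^nat) (x : R).
Hypothesis cx : c n @[n --> \oo] --> x.

(* The event that the statistic is at most [x] is [sq_coherence <= r / M] with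
   [M = p - 1], [v = M (1 - t^2)], [r = v + t^2 y] and [y = c - ln v], where [c]
   tends to [x]. *)
Definition level n : R := c n - ln (v n).
Local Notation y := level.

Let near_v1 : \forall n \near \oo, 1 <= v n.
Proof.
have := cvg_invgap => /cvgr0Pnorm_lt /(_ 1 ltr01) H.
near=> n; have n2 : (2 <= n)%N by near: n.
have : `|(v n)^-1| < 1 by near: n.
have v0 := gap_gt0 n2; rewrite ger0_norm ?invr_ge0 ?(ltW v0) //.
by rewrite invf_lt1 // => /ltW.
Unshelve. all: by end_near. Qed.

Let cvg_lnv2 : ln (v n) ^+ 2 / v n @[n --> \oo] --> 0.
Proof.
apply: (squeeze0 (g := fun n => 16 * Num.sqrt (v n)^-1)).
  near=> n; have v1 : 1 <= v n by near: n.
  have v0 : 0 <= v n by lra.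
  rewrite ger0_norm; last by rewrite divr_ge0 ?sqr_ge0.
  by rewrite sqrtrV // ln_sqr_le.
rewrite -[X in _ --> X](mulr0 16); apply: cvgM; first exact: cvg_cst.
by rewrite -[X in _ --> X]sqrtr0; apply: cvg_sqrt; exact: cvg_invgap.
Unshelve. all: by end_near. Qed.

(** The level grows only like [ln v]. This one estimate makes the first-order terms vanish as well,
    through [|y| <= 1 + y^2] and [v <= M]. *)
Lemma cvg_level_sqr : y n ^+ 2 / v n @[n --> \oo] --> 0.
Proof.
apply: (squeeze0 (g := fun n => 2 * (c n ^+ 2 * (v n)^-1) +
    2 * (ln (v n) ^+ 2 / v n))); last first.
  rewrite -[X in _ --> X]addr0; apply: cvgD; last first.
    rewrite -[X in _ --> X](mulr0 2); apply: cvgM; first exact: cvg_cst.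
    exact: cvg_lnv2.
  rewrite -[X in _ --> X](mulr0 2); apply: cvgM; first exact: cvg_cst.
  rewrite -[X in _ --> X](mulr0 (x ^+ 2)); apply: cvgM; last exact: cvg_invgap.
  exact: (cvg_comp _ _ cx (@exprn_continuous _ 2 x)).
near=> n; have v1 : 1 <= v n by near: n.
have v0 : 0 < v n by lra.
rewrite ger0_norm ?divr_ge0 ?sqr_ge0 ?(ltW v0) // !mulrA -mulrDl.
rewrite ler_pM2r ?invr_gt0 // /level.
by have := sqr_ge0 (c n + ln (v n)); nra.
Unshelve. all: by end_near. Qed.

Let level_le n : `|y n| <= 1 + y n ^+ 2.
Proof.
rewrite ler_norml; have h1 := sqr_ge0 (y n - 2^-1).
by have h2 := sqr_ge0 (y n + 2^-1); apply/andP; split; nra.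
Qed.

Let boundE n : (v n)^-1 + y n ^+ 2 / v n = (1 + y n ^+ 2) / v n.
Proof. by rewrite mulrDl mul1r. Qed.

Let cvg_bound : (v n)^-1 + y n ^+ 2 / v n @[n --> \oo] --> 0.
Proof.
rewrite -[X in _ --> X]addr0; apply: cvgD; first exact: cvg_invgap.
exact: cvg_level_sqr.
Qed.

Lemma cvg_level_gap : t n ^+ 2 * y n / v n @[n --> \oo] --> 0.
Proof.
apply: (squeeze0 _ cvg_bound); near=> n; have n2 : (2 <= n)%N by near: n.
have v0 := gap_gt0 n2; have t1 := tpar_sqr_lt1 n2.
rewrite normrM normfV (gtr0_norm v0) normrM (ger0_norm (sqr_ge0 _)).
rewrite boundE ler_pM2r ?invr_gt0 //.
by rewrite (le_trans _ (level_le n)) // ler_piMl // ltW.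
Unshelve. all: by end_near. Qed.

Let cvg_yM : y n / M n @[n --> \oo] --> 0.
Proof.
apply: (squeeze0 _ cvg_bound); near=> n; have n2 : (2 <= n)%N by near: n.
have v0 := gap_gt0 n2; have vM := gap_le n2; have M0 := lt_le_trans v0 vM.
rewrite normrM normfV (gtr0_norm M0).
by rewrite boundE ler_pM ?invr_ge0 ?(ltW M0) // lef_pV2.
Unshelve. all: by end_near. Qed.

Let cvg_y2M : y n ^+ 2 / M n @[n --> \oo] --> 0.
Proof.
apply: (squeeze0 _ cvg_level_sqr); near=> n; have n2 : (2 <= n)%N by near: n.
have v0 := gap_gt0 n2; have vM := gap_le n2; have M0 := lt_le_trans v0 vM.
rewrite ger0_norm ?divr_ge0 ?sqr_ge0 ?(ltW M0) //.
by rewrite ler_wpM2l ?sqr_ge0 // lef_pV2.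
Unshelve. all: by end_near. Qed.

Definition scaled_level n : R := v n + t n ^+ 2 * y n.
Local Notation r := scaled_level.

Let cvg_rv : r n / v n @[n --> \oo] --> (1 : R).
Proof.
have : 1 + t n ^+ 2 * y n / v n @[n --> \oo] --> (1 + 0 : R).
  by apply: cvgD; [exact: cvg_cst|exact: cvg_level_gap].
rewrite addr0; apply: cvg_trans; apply: near_eq_cvg.
near=> n; have n2 : (2 <= n)%N by near: n.
by rewrite /scaled_level mulrDl mulfV // gt_eqF // gap_gt0.
Unshelve. all: by end_near. Qed.

Lemma near_scaled_level_gt0 : \forall n \near \oo, 0 < r n.
Proof.
have H := cvgr_gt _ cvg_rv _ ltr01.
near=> n; have n2 : (2 <= n)%N by near: n.
have : 0 < r n / v n by near: n; exact: H.
by rewrite pmulr_lgt0 // invr_gt0 gap_gt0.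
Unshelve. all: by end_near. Qed.

Let cvg_invr : (r n)^-1 @[n --> \oo] --> 0.
Proof.
have : (r n / v n)^-1 * (v n)^-1 @[n --> \oo] --> (1^-1 * 0 : R).
  by apply: cvgM; [apply: cvgV|exact: cvg_invgap].
rewrite mulr0; apply: cvg_trans; apply: near_eq_cvg.
near=> n; have n2 : (2 <= n)%N by near: n.
have r0 : 0 < r n by near: n; exact: near_scaled_level_gt0.
by field; rewrite !gt_eqF // gap_gt0.
Unshelve. all: by end_near. Qed.

Let sqrt_expR (a : R) : 0 < a -> Num.sqrt a = expR (ln a / 2).
Proof.
move=> a0; rewrite -{1}(lnK (x := a)) ?posrE //.
have -> : expR (ln a) = expR (ln a / 2) ^+ 2.
  by rewrite -expRM_natl; congr expR; field.
by rewrite sqrtr_sqr ger0_norm // expR_ge0.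
Qed.

(** The power is [exp ((e - y) / 2)] with [e] tending to 0. Since [y = c - ln v], it contains a
    factor [sqrt v], which cancels [sqrt r] because [r / v] tends to 1. *)
Let cvg_main : Num.sqrt (1 - y n / M n) ^+ (p n).-1 / Num.sqrt (r n)
  @[n --> \oo] --> expR (- (x / 2)).
Proof.
pose e n := M n * (ln (1 - y n / M n) + y n / M n).
have yM_small : \forall n \near \oo, `|y n / M n| < 2^-1.
  by move/cvgr0Pnorm_lt : cvg_yM; apply; rewrite invr_gt0.
have e0 : e n @[n --> \oo] --> 0.
  apply: (squeeze0 (g := fun n => 2 * (y n ^+ 2 / M n))); last first.
    rewrite -[X in _ --> X](mulr0 2); apply: cvgM; first exact: cvg_cst.
    exact: cvg_y2M.
  near=> n; have n2 : (2 <= n)%N by near: n.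
  have M0 : 0 < M n by exact: lt_le_trans (sphere_dim_ge1 n2).
  have u2 : `|y n / M n| <= 2^-1 by apply: ltW; near: n; exact: yM_small.
  rewrite /e normrM (gtr0_norm M0).
  apply: (le_trans (ler_wpM2l (ltW M0) (ln1B_approx u2))).
  by rewrite le_eqVlt; apply/orP; left; apply/eqP; field; rewrite gt_eqF.
have : expR ((e n - c n - ln (r n / v n)) / 2) @[n --> \oo] -->
    expR ((0 - x - ln 1) / 2).
  apply: cvg_expR; apply: cvgM; last exact: cvg_cst.
  by apply: cvgB; [apply: cvgB|apply: cvg_ln].
rewrite ln1 subr0 sub0r mulNr; apply: cvg_trans; apply: near_eq_cvg.
near=> n; have n2 : (2 <= n)%N by near: n.
have M0 : 0 < M n by exact: lt_le_trans (sphere_dim_ge1 n2).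
have v0 := gap_gt0 n2.
have r0 : 0 < r n by near: n; exact: near_scaled_level_gt0.
have u2 : `|y n / M n| < 2^-1 by near: n; exact: yM_small.
have u0 : 0 < 1 - y n / M n.
  by move: u2; rewrite ltr_norml => /andP[]; lra.
rewrite !sqrt_expR // -expRM_natl -expRN -expRD -sphere_dimE //; congr expR.
rewrite ln_div ?posrE // /e mulrDr mulrCA mulfV ?gt_eqF // mulr1 /level.
by field.
Unshelve. all: by end_near. Qed.

(* [q] is sandwiched by [cap_probability_bounds] at the level [r / M], where
   [1 - r / M = t^2 (1 - y / M)] and [t^M = n^-2]. *)
Lemma cap_asymptotics (q : R^nat) :
  (\forall n \near \oo, 0 < r n / M n < 1 ->
    let Q := wallis (p n).-2 * q n in
    (M n * Q * Num.sqrt (r n / M n) <= Num.sqrt (1 - r n / M n) ^+ (p n).-1) /\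
    (Num.sqrt (1 - r n / M n) ^+ (p n).-1 <=
       M n * Q * Num.sqrt (r n / M n) * (1 + (M n * (r n / M n))^-1))) ->
  n%:R ^+ 2 * q n @[n --> \oo] --> expR (- (x / 2)) / Num.sqrt (pi / 2).
Proof.
move=> qb.
have pred_p : (p n).-1 @[n --> \oo] --> \oo.
  move/cvgnyPge : p_infty => H; apply/cvgnyPge => A; near=> n.
  have : (A.+1 <= p n)%N by near: n; exact: H.
  by case: (p n).
have Bcvg := wallis_cvg pred_p.
pose A n := Num.sqrt (1 - y n / M n) ^+ (p n).-1 / Num.sqrt (r n) /
  (Num.sqrt (p n).-1%:R * wallis (p n).-2).
have Acvg : A n @[n --> \oo] --> expR (- (x / 2)) / Num.sqrt (pi / 2).
  apply: cvgM; first exact: cvg_main.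
  apply: cvgV; last exact: Bcvg.
  by rewrite gt_eqF // sqrtr_gt0 divr_gt0 // pi_gt0.
have A'cvg : A n / (1 + (r n)^-1) @[n --> \oo] -->
    expR (- (x / 2)) / Num.sqrt (pi / 2).
  have : A n / (1 + (r n)^-1) @[n --> \oo] -->
      expR (- (x / 2)) / Num.sqrt (pi / 2) * (1 + 0)^-1.
    apply: cvgM => //; apply: cvgV; first by rewrite addr0 oner_neq0.
    by apply: cvgD; [exact: cvg_cst|exact: cvg_invr].
  by rewrite addr0 invr1 mulr1.
apply: (squeeze_cvgr _ A'cvg Acvg).
have yM_small : \forall n \near \oo, `|y n / M n| < 2^-1.
  by move/cvgr0Pnorm_lt : cvg_yM; apply; rewrite invr_gt0.
near=> n; have n2 : (2 <= n)%N by near: n.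
have M0 : 0 < M n by exact: lt_le_trans (sphere_dim_ge1 n2).
have v0 := gap_gt0 n2; have t0 := tpar_gt0 n.
have r0 : 0 < r n by near: n; exact: near_scaled_level_gt0.
have u2 : `|y n / M n| < 2^-1 by near: n; exact: yM_small.
have u0 : 0 < 1 - y n / M n.
  by move: u2; rewrite ltr_norml => /andP[]; lra.
have rME : 1 - r n / M n = t n ^+ 2 * (1 - y n / M n).
  by rewrite /scaled_level /gap; field; rewrite gt_eqF.
have rM01 : 0 < r n / M n < 1.
  rewrite divr_gt0 //= -subr_gt0 rME mulr_gt0 // exprn_gt0 //.
have : 0 < r n / M n < 1 ->
    let Q := wallis (p n).-2 * q n in
    (M n * Q * Num.sqrt (r n / M n) <= Num.sqrt (1 - r n / M n) ^+ (p n).-1) /\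
    (Num.sqrt (1 - r n / M n) ^+ (p n).-1 <=
       M n * Q * Num.sqrt (r n / M n) * (1 + (M n * (r n / M n))^-1)).
  by near: n; exact: qb.
have st : Num.sqrt (t n ^+ 2 * (1 - y n / M n)) = t n * Num.sqrt (1 - y n / M n).
  by rewrite sqrtrM ?sqr_ge0 // sqrtr_sqr gtr0_norm.
move=> /(_ rM01) /=; rewrite rME st exprMn tpar_pow // [M n * (r n / M n)]mulrC divfK ?gt_eqF //.
set W := wallis _; have W0 : 0 < W by exact: wallis_gt0.
rewrite /A -/W -sphere_dimE //; set E := Num.sqrt (1 - _) ^+ _.
have sM0 : 0 < Num.sqrt (M n) by rewrite sqrtr_gt0.
have sr0 : 0 < Num.sqrt (r n) by rewrite sqrtr_gt0.
have -> : Num.sqrt (r n / M n) = Num.sqrt (r n) / Num.sqrt (M n).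
  by rewrite sqrtrM ?(ltW r0) // sqrtrV // ltW.
have ME : M n = Num.sqrt (M n) ^+ 2 by rewrite sqr_sqrtr // ltW.
(* One factor [sqrt M] survives and pairs with [W], forming the product whose limit is given by
   [wallis_cvg]. *)
have -> : M n * (W * q n) * (Num.sqrt (r n) / Num.sqrt (M n)) =
    q n * (Num.sqrt (M n) * W * Num.sqrt (r n)).
  by rewrite {1}ME; field; rewrite gt_eqF.
set G := Num.sqrt (M n) * W * Num.sqrt (r n).
have G0 : 0 < G by rewrite !mulr_gt0.
have -> : E / Num.sqrt (r n) / (Num.sqrt (M n) * W) = E / G.
  by rewrite /G; field; rewrite !gt_eqF.
have N0 : 0 < n%:R ^+ 2 :> R by rewrite exprn_gt0 // ltr0n (ltn_trans _ n2).
have R0 : 0 < 1 + (r n)^-1 by rewrite addr_gt0 // invr_gt0.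
move=> [lo up]; apply/andP; split.
- rewrite ler_pdivrMr // ler_pdivrMr //.
  have := ler_wpM2l (ltW N0) up; rewrite mulrA mulfV ?gt_eqF // mul1r.
  by move=> h; apply: (le_trans h); rewrite le_eqVlt; apply/orP; left; apply/eqP; ring.
- rewrite ler_pdivlMr //; have := ler_wpM2l (ltW N0) lo.
  by rewrite [X in _ <= X]mulrA mulfV ?gt_eqF // mul1r mulrA.
Unshelve. all: by end_near. Qed.

End CapAsymptotics.

(** * The limit law *)

Lemma cap_probability_bounds_unit (R : realType) (p : nat)
  (mu : probability (p.-tuple R) R) (u : p.-tuple R) (s : R) :
  (2 <= p)%N -> uniform_on_sphere mu -> dotv u u = 1 -> 0 < s < 1 ->
  let Q := wallis p.-2 * fine (mu [set y | s < dotv u y ^+ 2]) in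
  (p.-1%:R * Q * Num.sqrt s <= Num.sqrt (1 - s) ^+ p.-1) /\
  (Num.sqrt (1 - s) ^+ p.-1 <=
     p.-1%:R * Q * Num.sqrt s * (1 + (p.-1%:R * s)^-1)).
Proof.
case: p mu u => [|[|m]] // mu u _ unif uu /andP[s0 s1] /=.
pose e : m.+2.-tuple R := unit_tuple R ord0.
have := cap_probability_bounds unif s0 s1.
have -> : [set y : m.+2.-tuple R | s < tnth y ord0 ^+ 2] =
    [set y | s < dotv e y ^+ 2].
  by apply/seteqP; split=> y /=; rewrite dotv_unitl.
by rewrite (dotv_law_unit unif (measurable_sqr_gt s) (dotv_unit _ _) uu).
Qed.

Section CapOfFamily.
Context (R : realType) (d : measure_display) (T : measurableType d)
  (P : probability T R) (n p : nat) (X : 'I_n -> {RV P >-> p.-tuple R}).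
Hypothesis indX : mutually_independent X.
Hypothesis unifX : forall i, uniform_on_sphere (distribution P (X i)).

(** Both caps have the probability of the edge between [i] and [l], seen from its two ends. *)
Lemma cap_law_eq r u i l : dotv u u = 1 ->
  distribution P (X i) [set y | r < dotv u y ^+ 2] =
  distribution P (X l) [set y | r < dotv u y ^+ 2].
Proof.
move=> uu; have [->//|il] := eqVneq i l.
have E j k : j != k -> P (edge X r j k) =
    distribution P (X k) [set y | r < dotv u y ^+ 2].
  move=> jk; rewrite -[edge X r j k]setTI (edge_indep indX unifX r uu jk).
    by rewrite probability_setT mul1e.
  exact: (@measurableT _ (g_sigma_algebraType (cylinders_off X k))).
by rewrite -(E l i) 1?eq_sym // -(E i l) // edgeC.
Qed.

Lemma cap_law_ex r : (0 < n)%N -> (2 <= p)%N -> exists q : R,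
  (exists2 u : p.-tuple R, dotv u u = 1 & forall l,
     distribution P (X l) [set y | r < dotv u y ^+ 2] = q%:E) /\
  (0 < r < 1 -> let Q := wallis p.-2 * q in
   (p.-1%:R * Q * Num.sqrt r <= Num.sqrt (1 - r) ^+ p.-1) /\
   (Num.sqrt (1 - r) ^+ p.-1 <=
     p.-1%:R * Q * Num.sqrt r * (1 + (p.-1%:R * r)^-1))).
Proof.
move=> n0 p2; pose u : p.-tuple R := unit_tuple R (Ordinal (ltnW p2)).
have uu : dotv u u = 1 by exact: dotv_unit.
pose i0 := Ordinal n0.
exists (fine (distribution P (X i0) [set y | r < dotv u y ^+ 2])); split.
  exists u => // l; rewrite fineK; first exact: cap_law_eq.
  apply: fin_num_measure; apply: (@measurable_dotv_preimage _ _ u [set x | r < x ^+ 2]).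
  exact: measurable_sqr_gt.
by move=> r01; exact: (cap_probability_bounds_unit p2 (unifX i0) uu r01).
Qed.

(** The sign of [r] matters because the maximum starts from the default value 0. *)
Lemma sq_coherence_le r : 0 <= r ->
  [set w | sq_coherence (fun i => X i w) <= r] = noedge X r n.
Proof.
move=> r0; apply/seteqP; split=> w /=.
  move=> /bigmax_leP[_ le_r] i j ij _; rewrite /edge /=.
  by apply/negP; rewrite -leNgt; exact: (le_r (i, j)).
move=> N; apply/bigmax_leP; split=> // -[i j] /= ij.
by rewrite leNgt; apply/negP; exact: N.
Qed.

Lemma coherence_le r : 0 <= r ->
  [set w | coherence (fun i => X i w) <= r] =
  [set w | sq_coherence (fun i => X i w) <= r ^+ 2].
Proof.
have sq_le (a : R) : 0 <= r -> (`|a| <= r) = (a ^+ 2 <= r ^+ 2).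
  move=> r0; rewrite -[a ^+ 2]real_normK ?num_real //.
  by rewrite ler_pXn2r ?nnegrE.
move=> r0; apply/seteqP; split=> w /= /bigmax_leP[_ le_r];
  apply/bigmax_leP; split; rewrite ?sqr_ge0 // => ij ij12.
  by rewrite -sq_le //; exact: le_r.
by rewrite sq_le //; exact: le_r.
Qed.

Lemma measurable_bigmax (I : Type) (s : seq I) (Q : pred I) (F : I -> T -> R) :
  (forall i, measurable_fun setT (F i)) ->
  measurable_fun setT (fun w => \big[Num.max/0]_(i <- s | Q i) F i w).
Proof.
move=> mF; elim: s => [|i s IH].
  by under eq_fun do rewrite big_nil; exact: measurable_cst.
under eq_fun do rewrite big_cons.
by case: (Q i) => //; exact: measurable_maxr.
Qed.

Lemma measurable_coherence :
  measurable_fun setT (fun w => coherence (fun i => X i w)).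
Proof.
apply: measurable_bigmax => ij; apply: measurableT_comp => //.
by apply: measurable_dotv; exact: measurable_funP.
Qed.

Lemma measurable_sq_coherence :
  measurable_fun setT (fun w => sq_coherence (fun i => X i w)).
Proof.
apply: measurable_bigmax => ij; apply: measurable_funX.
by apply: measurable_dotv; exact: measurable_funP.
Qed.

End CapOfFamily.

Section Limit.
Context (R : realType) (p : nat -> nat).
Hypothesis p_ge2 : forall n, (2 <= n)%N -> (2 <= p n)%N.
Hypothesis p_infty : p @ \oo --> \oo.
Context (d : nat -> measure_display) (T : forall n, measurableType (d n))
  (P : forall n, probability (T n) R)
  (X : forall n, 'I_n -> {RV (P n) >-> (p n).-tuple R}).
Arguments X : clear implicits.
Hypothesis indX : forall n, (2 <= n)%N -> mutually_independent (X n).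
Hypothesis unifX : forall n, (2 <= n)%N ->
  forall i : 'I_n, uniform_on_sphere (distribution (P n) (X n i)).

Lemma cvg_invn : (n%:R)^-1 @[n --> \oo] --> (0 : R).
Proof.
apply/gtr0_cvgV0; last exact: cvgr_idn.
by exists 1%N => // n /= n1; rewrite ltr0n.
Qed.

(** The form in which the limit arises: cap asymptotics times the limit of ['C(n, 2) / n^2], with
    [sqrt (2 pi) = 2 sqrt (pi / 2)]. *)
Lemma Lambda1E (x : R) : Lambda1 x =
  expR (- (expR (- (x / 2)) / Num.sqrt (pi / 2) * (2^-1 * (1 - 0)))).
Proof.
rewrite /Lambda1 subr0 mulr1; congr (expR (- _)).
have -> : 2 * pi = 2 ^+ 2 * (pi / 2) :> R by field.
rewrite sqrtrM ?sqr_ge0 // sqrtr_sqr ger0_norm // invfM mulrC mulrA.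
by rewrite mulrAC.
Qed.

Lemma bin2_natr (n : nat) : (0 < n)%N ->
  'C(n, 2)%:R = n%:R ^+ 2 * (2^-1 * (1 - n%:R^-1)) :> R.
Proof.
move=> n0; have n1 : n%:R != 0 :> R by rewrite pnatr_eq0 -lt0n.
have : (2 * 'C(n, 2))%:R = (n * n.-1)%:R :> R by rewrite -mul_bin_diag bin1.
rewrite !natrM -subn1 natrB // => e.
apply: (mulfI (_ : 2 != 0 :> R)); first by rewrite pnatr_eq0.
by rewrite e; field.
Qed.

Lemma sq_coherence_cvg (c : R^nat) (x : R) : c n @[n --> \oo] --> x ->
  P n [set w | sq_coherence (fun i => X n i w) <=
    scaled_level p c n / sphere_dim R p n] @[n --> \oo] --> (Lambda1 x)%:E.
Proof.
move=> cx; pose s n := scaled_level p c n / sphere_dim R p n.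
have near2 : \forall n \near \oo, (2 <= n)%N by exists 2%N.
have /choice[q hq] n : exists q : R, (2 <= n)%N ->
    (exists2 u : (p n).-tuple R, dotv u u = 1 & forall l : 'I_n,
      distribution (P n) (X n l) [set y | s n < dotv u y ^+ 2] = q%:E) /\
    (0 < s n < 1 -> let Q := wallis (p n).-2 * q in
     ((p n).-1%:R * Q * Num.sqrt (s n) <= Num.sqrt (1 - s n) ^+ (p n).-1) /\
     (Num.sqrt (1 - s n) ^+ (p n).-1 <=
       (p n).-1%:R * Q * Num.sqrt (s n) * (1 + ((p n).-1%:R * s n)^-1))).
  have [n2|n2] := leqP 2 n; last by exists 0.
  have [q hq] := cap_law_ex (indX n2) (unifX n2) (s n) (ltnW n2) (p_ge2 n2).
  by exists q.
have qcvg : n%:R ^+ 2 * q n @[n --> \oo] --> expR (- (x / 2)) / Num.sqrt (pi / 2).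
  apply: (cap_asymptotics p_ge2 p_infty cx); near=> n => s01.
  have n2 : (2 <= n)%N by near: n.
  by have [_ /(_ s01)] := hq n n2; rewrite -(sphere_dimE R p_ge2 n2).
pose a n := fine (P n (noedge (X n) (s n) n)).
pose b n := expR (- (q n * 'C(n, 2)%:R)).
have bcvg : b n @[n --> \oo] --> Lambda1 x.
  rewrite Lambda1E.
  have : expR (- (n%:R ^+ 2 * q n * (2^-1 * (1 - n%:R^-1)))) @[n --> \oo] -->
      expR (- (expR (- (x / 2)) / Num.sqrt (pi / 2) * (2^-1 * (1 - 0)))).
    apply: cvg_expR; apply: cvgN; apply: cvgM => //.
    apply: cvgM; first exact: cvg_cst.
    by apply: cvgB; [exact: cvg_cst|exact: cvg_invn].
  apply: cvg_trans; apply: near_eq_cvg; near=> n.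
  have n2 : (2 <= n)%N by near: n.
  rewrite /b bin2_natr; last exact: ltnW.
  by congr (expR (- _)); ring.
have abcvg : a n - b n @[n --> \oo] --> 0.
  (* The error [2 n^3 q^2] of [noedge_approx], written with the convergent quantity [n^2 q]. *)
  apply: (squeeze0 (g := fun n => 2 * (n%:R ^+ 2 * q n) ^+ 2 * n%:R^-1)).
    near=> n; have n2 : (2 <= n)%N by near: n.
    have [[u uu capE] _] := hq n n2.
    have := noedge_approx (indX n2) (unifX n2) uu capE (leqnn n).
    rewrite -/(a n) -/(b n) => /le_trans; apply.
    rewrite le_eqVlt; apply/orP; left; apply/eqP; field.
    by rewrite pnatr_eq0 -lt0n ltnW.
  pose K := expR (- (x / 2)) / Num.sqrt (pi / 2) : R.
  have : 2 * (n%:R ^+ 2 * q n) ^+ 2 * n%:R^-1 @[n --> \oo] --> 2 * K ^+ 2 * 0.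
    apply: cvgM; last exact: cvg_invn.
    apply: cvgM; first exact: cvg_cst.
    exact: (cvg_comp _ _ qcvg (@exprn_continuous _ 2 K)).
  by rewrite mulr0.
have acvg : a n @[n --> \oo] --> Lambda1 x.
  have : b n + (a n - b n) @[n --> \oo] --> Lambda1 x + 0 by exact: cvgD.
  by rewrite addr0; under eq_fun do rewrite addrC subrK.
have : (a n)%:E @[n --> \oo] --> (Lambda1 x)%:E.
  by apply: cvg_EFin; [near=> n|exact: acvg].
apply: cvg_trans; apply: near_eq_cvg; near=> n.
have n2 : (2 <= n)%N by near: n.
have s0 : 0 <= s n.
  apply: divr_ge0; last exact: le_trans ler01 (sphere_dim_ge1 R p_ge2 n2).
  apply: ltW; near: n; exact: near_scaled_level_gt0 cx.
rewrite -/(s n) sq_coherence_le // /a fineK //.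
by apply: fin_num_measure; exact: measurable_noedge.
Unshelve. all: by end_near. Qed.

End Limit.

Theorem corollary2p2 (R : realType)
  (p : nat -> nat) (hp2 : forall n, (2 <= n)%N -> (2 <= p n)%N)
  (hp : p @ \oo --> \oo)
  (d : nat -> measure_display) (T : forall n, measurableType (d n))
  (P : forall n, probability (T n) R)
  (X : forall n, 'I_n -> {RV (P n) >-> (p n).-tuple R})
  (hind : forall n, (2 <= n)%N -> mutually_independent (X n))
  (hunif : forall n, (2 <= n)%N ->
     forall i : 'I_n, uniform_on_sphere (distribution (P n) (X n i))) :
  let t n : R := tpar R n (p n) in
  let alpha n : R := alphapar R n (p n) in
  let L n (w : T n) : R := coherence (fun i : 'I_n => X n i w) in
  let Lbar n (w : T n) : R := sq_coherence (fun i : 'I_n => X n i w) in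
  cvg_in_distribution P
    (fun n w => 1 / (alpha n * t n) * (L n w - Num.sqrt (1 - t n ^+ 2))
                + ln (((p n)%:R - 1) * (1 - t n ^+ 2)))
    (@Lambda1 R) /\
  cvg_in_distribution P
    (fun n w => ((p n)%:R - 1) / t n ^+ 2 * (Lbar n w - (1 - t n ^+ 2))
                + ln (((p n)%:R - 1) * (1 - t n ^+ 2)))
    (@Lambda1 R).
Proof.
move=> t alpha L Lbar.
have near2 : \forall n \near \oo, (2 <= n)%N by exists 2%N.
pose v n := gap R p n; pose M n := sphere_dim R p n.
have M_gt0 n : (2 <= n)%N -> 0 < M n.
  by move=> n2; exact: lt_le_trans (sphere_dim_ge1 R hp2 n2).
split; split.
- move=> n; apply: measurable_funD; last exact: measurable_cst.
  apply: measurable_funM; first exact: measurable_cst.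
  apply: measurable_funB; last exact: measurable_cst.
  exact: measurable_coherence.
- move=> x _; pose y n := level p (fun=> x) n.
  (* Squaring the threshold for [L] shifts the level by [t^2 y^2 / (4 v)]. *)
  pose c n : R := x + t n ^+ 2 * y n ^+ 2 / (4 * v n).
  have xx : (fun=> x : R) n @[n --> \oo] --> x by exact: cvg_cst.
  have cx : c n @[n --> \oo] --> x.
    rewrite -[X in _ --> X]addr0; apply: cvgD; first exact: xx.
    apply: (squeeze0 _ (cvg_level_sqr hp2 hp xx)).
    near=> n; have n2 : (2 <= n)%N by near: n.
    have v0 := gap_gt0 R hp2 n2; have t1 := tpar_sqr_lt1 R hp2 n2.
    rewrite -/(v n) -/(y n) -/(t n) in v0 t1 *.
    rewrite ger0_norm; last first.
      by apply: divr_ge0; apply: mulr_ge0; rewrite ?sqr_ge0 // ltW.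
    rewrite invfM mulrA ler_pM2r ?invr_gt0 //.
    have := sqr_ge0 (y n); nra.
  have := sq_coherence_cvg hp2 hp hind hunif cx.
  apply: cvg_trans; apply: near_eq_cvg; near=> n.
  have n2 : (2 <= n)%N by near: n.
  have v0 := gap_gt0 R hp2 n2; have t1 := tpar_sqr_lt1 R hp2 n2.
  have t0 := tpar_gt0 R p n; have M0 := M_gt0 n n2.
  rewrite -/(v n) -/(t n) in v0 t0 t1.
  have u0 : 0 < 1 - t n ^+ 2 by rewrite subr_gt0.
  pose h := Num.sqrt (1 - t n ^+ 2); have h0 : 0 < h by rewrite sqrtr_gt0.
  have hE : h ^+ 2 = v n / M n.
    by rewrite sqr_sqrtr ?(ltW u0) // /v /gap mulrC mulKf // gt_eqF.
  (* The value of [L] at which the first statistic equals [x]: [1 / (alpha t) = 2 M h / t^2], and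
     [M h = v / h]. *)
  pose l := h * (1 + t n ^+ 2 * y n / v n / 2).
  (* Squaring the threshold requires its sign, which holds eventually since [t^2 y / v] tends to
     0. *)
  have l0 : 0 <= l.
    rewrite mulr_ge0 ?(ltW h0) //.
    have : `|t n ^+ 2 * y n / v n| < 1.
      near: n; move: (cvg_level_gap hp2 hp xx) => /cvgr0Pnorm_lt; apply.
      exact: ltr01.
    by rewrite ltr_norml => /andP[]; lra.
  have lE : l ^+ 2 = scaled_level p c n / sphere_dim R p n.
    rewrite /scaled_level -/(t n) -/(M n) -/(v n) /l exprMn hE.
    rewrite (_ : level p c n = y n + t n ^+ 2 * y n ^+ 2 / (4 * v n)); last first.
      by rewrite /level /c /y /level addrAC.
    by field; rewrite !gt_eqF.
  rewrite -lE -coherence_le //; congr (P n _); apply/seteqP.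
  have at0 : 0 < alpha n * t n.
    by rewrite /alpha /alphapar -/(t n) !mulr_gt0 ?invr_gt0 ?mulr_gt0.
  suff E w : (1 / (alpha n * t n) * (L n w - h) + ln (v n) <= x) = (L n w <= l).
    by split=> w /=; rewrite -/(L n w) -E.
  rewrite -lerBrDr mul1r mulrC ler_pdivrMr // lerBlDr; congr (_ <= _).
  rewrite /l /alpha /alphapar -/(t n) -/h -[(p n)%:R - 1]/(M n) -[x - _]/(y n).
  rewrite (_ : v n = M n * h ^+ 2); last by rewrite hE mulrC divfK // gt_eqF.
  by field; rewrite !gt_eqF.
- move=> n; apply: measurable_funD; last exact: measurable_cst.
  apply: measurable_funM; first exact: measurable_cst.
  apply: measurable_funB; last exact: measurable_cst.
  exact: measurable_sq_coherence.
- move=> x _; have xx : (fun=> x : R) n @[n --> \oo] --> x by exact: cvg_cst.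
  have := sq_coherence_cvg hp2 hp hind hunif xx.
  apply: cvg_trans; apply: near_eq_cvg; near=> n.
  have n2 : (2 <= n)%N by near: n.
  have t0 := tpar_gt0 R p n; have M0 := M_gt0 n n2.
  congr (P n _); apply/seteqP.
  suff E w : (M n / t n ^+ 2 * (Lbar n w - (1 - t n ^+ 2)) + ln (v n) <= x) =
      (Lbar n w <= scaled_level p (fun=> x) n / M n).
    by split=> w /=; rewrite -/(Lbar n w) -E.
  rewrite -lerBrDr mulrC -ler_pdivlMr; last by rewrite divr_gt0 ?exprn_gt0.
  rewrite lerBlDr; congr (_ <= _).
  rewrite /scaled_level /level -/(v n) -/(t n) {2}/v /gap -/(M n) -/(t n).
  by field; rewrite !gt_eqF.
Unshelve. all: by end_near. Qed.
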